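(* Fix positive integers $m,t$ and a tree $\Lambda$ with $t$ vertices. Let $W_n$ be the number of copies of $\Lambda$ in the uniform attachment graph $G^m_n$, let $\mu_n:=\mathbb{E}W_n$, $\sigma_n^2:=\mathrm{Var}(W_n)$, and $Y_n:=(W_n-\mu_n)/\sigma_n$. Then, as $n\to\infty$, $$\mu_n=\Theta(n),\qquad \sigma_n^2=O(n).$$ Moreover, if $\sigma_n^2=\Theta(n)$, then there is a constant $C=C(m,t)$ such that, for all sufficiently large $n$, $$d_{\mathrm{W}}\bigl(\mathcal{L}(Y_n),\mathcal{N}(0,1)\bigr)\le Cn^{-1/2}.$$
   Context: Uniform attachment graph: for integers $m,n\ge1$, $G^m_n$ is the random loopless multigraph on vertex set $[n]=\{1,\dots,n\}$ in which, for every $j\in\{2,\dots,n\}$ and every label $a\in[m]$, there is exactly one edge $j^{(a)}$ with label $a$ from $j$ to a vertex chosen uniformly at random in $[j-1]$, all choices being independent. Parallel edges are allowed and are distinguished by their labels (equivalently, $G^m_n$ is a random subgraph of the multigraph $K^m_n$ on $[n]$ having, for every $1\le i<j\le n$, $m$ edges $ji^{(1)},\dots,ji^{(m)}$ between $j$ and $i$). Copies: a copy of a graph $H$ in $G^m_n$ is a (not necessarily induced) subgraph of $G^m_n$ isomorphic to $H$ as an undirected, unlabelled multigraph; two copies are different if they differ as subgraphs (also if they differ only in edge labels). $\mathcal{L}(X)$ is the law of $X$, $\mathcal{N}(0,1)$ the standard normal distribution. The Wasserstein distance is $d_{\mathrm{W}}(\nu_1,\nu_2)=\sup_f|\int f\,d\nu_1-\int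 f\,d\nu_2|$, supremum over all $f:\mathbb{R}\to\mathbb{R}$ with $|f(x)-f(y)|\le|x-y|$ for all $x,y$. $a_n=\Theta(b_n)$ means that there are constants $0<c\le C'<\infty$ not depending on $n$ with $cb_n\le a_n\le C'b_n$ for all sufficiently large $n$. *)

(* Defs.v *)
From HB Require Import structures.
From mathcomp Require Import all_boot all_order all_algebra.
From mathcomp Require Import all_classical all_reals all_analysis.

Set Implicit Arguments.
Unset Strict Implicit.
Unset Printing Implicit Defensive.

Import Order.TTheory GRing.Theory Num.Theory.
Import numFieldNormedType.Exports.

Local Open Scope classical_set_scope.
Local Open Scope ring_scope.

(* Vertices are 0-indexed: the vertex set is ['I_n] and every [j] with [0 < j]
   attaches to older vertices.  The pair [(j, a)] is the edge labelled [a] going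
   out of [j]. *)
Definition edge (m n : nat) : finType := ({j : 'I_n | (0 < j)%N} * 'I_m)%type.

Definition edge_source m n (e : edge m n) : 'I_n := val e.1.

(* The edge [(j, a)] picks an element of ['I_j], i.e. one of the [j] vertices
   that are older than [j]. *)
Definition outcome (m n : nat) : Type :=
  {dffun forall e : edge m n, 'I_(edge_source e)}.

Definition edge_target m n (w : outcome m n) (e : edge m n) : 'I_n :=
  widen_ord (ltnW (ltn_ord (edge_source e))) (w e).

HB.instance Definition _ m n := Finite.on (outcome m n).

HB.instance Definition _ m n := isPointed.Build (outcome m n)
  (finfun (fun e : edge m n => Ordinal (valP e.1))).

HB.instance Definition _ m n := @isMeasurable.Build default_measure_display
  (outcome m n) discrete_measurable discrete_measurable0
  discrete_measurableC discrete_measurableU.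

(* Product of the uniform distributions on the sets of available choices. *)
Definition attach_pmf (R : realType) m n (w : outcome m n) : R :=
  \prod_(e : edge m n) #|'I_(edge_source e)|%:R^-1.

Definition attach_prob (R : realType) m n : set (outcome m n) -> \bar R :=
  fun A => (\sum_(w \in A) (attach_pmf R w)%:E)%E.
Arguments attach_prob : clear implicits.

Section attach_probability.
Context {R : realType} {m n : nat}.

Lemma attach_pmf_ge0 (w : outcome m n) : 0 <= attach_pmf R w.
Proof. by apply: prodr_ge0 => e _; rewrite invr_ge0 ler0n. Qed.

Lemma attach_pmf_sum1 : \sum_(w : outcome m n) attach_pmf R w = 1.
Proof.
rewrite /attach_pmf sumr_const -mulr_natr.
have -> : #|{: outcome m n}| = (\prod_(e : edge m n) #|'I_(edge_source e)|)%N.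
  by rewrite card_dep_ffun foldrE big_map big_enum.
rewrite natr_prod -big_split/= big1// => e _.
by rewrite mulVf// card_ord pnatr_eq0 -lt0n; exact: (valP e.1).
Qed.

Let attach_prob0 : attach_prob R m n set0 = 0.
Proof. by rewrite /attach_prob fsbig_set0. Qed.

Let attach_prob_ge0 A : (0 <= attach_prob R m n A)%E.
Proof.
rewrite /attach_prob fsbig_finite//= sumEFin lee_fin.
by apply: sumr_ge0 => w _; exact: attach_pmf_ge0.
Qed.

Let attach_prob_sigma_additive : semi_sigma_additive (attach_prob R m n).
Proof.
move=> F mF tF mUF; rewrite /attach_prob.
apply: cvg_toP.
  apply: ereal_nondecreasing_is_cvgn => p q pq.
  by apply: lee_sum_nneg_natr => // k _ _; exact: attach_prob_ge0.
transitivity (\sum_(0 <= i <oo) (\esum_(w in F i) (attach_pmf R w)%:E))%E.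
  apply: eq_eseriesr => k _; rewrite esum_fset//= => w _.
  by rewrite lee_fin attach_pmf_ge0.
rewrite -nneseries_sum_bigcup//=; last first.
  by move=> w; rewrite lee_fin attach_pmf_ge0.
by rewrite esum_fset//= => w _; rewrite lee_fin attach_pmf_ge0.
Qed.

HB.instance Definition _ := isMeasure.Build _ _ _ (attach_prob R m n)
  attach_prob0 attach_prob_ge0 attach_prob_sigma_additive.

Let attach_prob_setT : attach_prob R m n [set: outcome m n] = 1%E.
Proof.
rewrite /attach_prob -attach_pmf_sum1 -sumEFin.
rewrite [RHS]fsbig_seq ?index_enum_uniq//; apply: eq_fsbigl.
by apply/seteqP; split => w //= _; rewrite mem_index_enum.
Qed.

HB.instance Definition _ :=
  Measure_isProbability.Build _ _ _ (attach_prob R m n) attach_prob_setT.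

(* The choices are uniform and mutually independent. *)
Lemma attach_prob_cylinder (E : {set edge m n}) (v : outcome m n) :
  attach_prob R m n [set w : outcome m n | forall e, e \in E -> w e = v e] =
  (\prod_(e in E) (edge_source e)%:R^-1)%:E.
Proof.
pose F e : pred 'I_(edge_source e) := fun i => (e \in E) ==> (i == v e).
have -> : [set w : outcome m n | forall e, e \in E -> w e = v e] =
          [set` family F].
  apply/seteqP; split => w /=.
    by move=> wE; apply/familyP => e; apply/implyP => /wE ->.
  by move=> /familyP wF e eE; apply/eqP; have /implyP := wF e; exact.
have Fe e : #|F e| = if e \in E then 1%N else #|'I_(edge_source e)|.
  by case: ifPn => eE; rewrite -?(card1 (v e)); apply: eq_card => i;
    rewrite !inE /in_mem/= /F ?eE ?(negbTE eE).
pose A : pred (outcome m n) := family F.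
have cardF : attach_prob R m n [set` family F] =
    (\sum_(w in A) attach_pmf R w)%:E.
  rewrite /attach_prob -sumEFin -[RHS]big_filter.
  rewrite [RHS]fsbig_seq ?filter_uniq ?index_enum_uniq//; apply: eq_fsbigl.
  by apply/seteqP; split => w /=; rewrite mem_filter mem_index_enum andbT.
rewrite cardF; congr (_%:E).
have cardA : #|A| = foldr muln 1%N [seq #|F e| | e : edge m n].
  exact: (card_family F).
rewrite sumr_const -mulr_natr cardA foldrE big_map big_enum/=.
rewrite natr_prod -big_split/= (bigID (mem E))/= [X in _ * X]big1 ?mulr1.
  by apply: eq_bigr => e eE; rewrite Fe eE mulr1 card_ord.
move=> e /negbTE eE; rewrite Fe eE mulVf// card_ord pnatr_eq0 -lt0n.
exact: (valP e.1).
Qed.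

End attach_probability.

Definition joins m n (w : outcome m n) (e : edge m n) (x y : 'I_n) : bool :=
  ((edge_source e == x) && (edge_target w e == y)) ||
  ((edge_source e == y) && (edge_target w e == x)).

Definition is_subgraph m n (w : outcome m n)
    (S : {set 'I_n}) (F : {set edge m n}) : bool :=
  [forall e in F, (edge_source e \in S) && (edge_target w e \in S)].

(* The subgraph [(S, F)], as an undirected unlabelled multigraph, is isomorphic
   to the simple graph [L]: some bijection from [V] onto [S] preserves the number
   of edges between any two vertices. *)
Definition subgraph_isom m n (w : outcome m n) (V : finType) (L : rel V)
    (S : {set 'I_n}) (F : {set edge m n}) : bool :=
  [exists phi : {ffun V -> 'I_n},
    [&& injectiveb phi, phi @: [set: V]%SET == S &
      [forall x, forall y,
        #|[set e in F | joins w e (phi x) (phi y)]%SET| == L x y]]].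

Definition num_copies m n (V : finType) (L : rel V) (w : outcome m n) : nat :=
  #|[set H : {set 'I_n} * {set edge m n} |
      is_subgraph w H.1 H.2 && subgraph_isom w L H.1 H.2]%SET|.

(* [ucycle L [:: x; y]] holds as soon as [L x y], because [L] is symmetric, so
   acyclicity only excludes cycles of length at least 3. *)
Definition is_tree (V : finType) (L : rel V) : Prop :=
  [/\ symmetric L, irreflexive L, (forall x y, connect L x y) &
      forall c : seq V, ucycle L c -> (size c <= 2)%N].

Section copies.
Context (R : realType) (m n : nat) (V : finType) (L : rel V).

Definition copies (w : outcome m n) : R := (num_copies L w)%:R.

Definition copies_mean : R := fine 'E_(attach_prob R m n)[copies].

Definition copies_var : R := fine 'V_(attach_prob R m n)[copies].

(* [measurableTypeR R] is [R] with its Borel sets, over which [normal_prob] is a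
   probability measure. *)
Definition copies_std (w : outcome m n) : measurableTypeR R :=
  (copies w - copies_mean) / Num.sqrt copies_var.

Let measurable_copies_std : measurable_fun [set: outcome m n] copies_std.
Proof. by []. Qed.

HB.instance Definition _ :=
  isMeasurableFun.Build _ _ _ _ copies_std measurable_copies_std.

Definition copies_std_law : probability (measurableTypeR R) R :=
  distribution (attach_prob R m n) copies_std.

End copies.

Definition wasserstein (R : realType)
    (nu1 nu2 : probability (measurableTypeR R) R) : \bar R :=
  ereal_sup [set `|\int[nu1]_x (f x)%:E - \int[nu2]_x (f x)%:E|%E |
    f in [set f : R -> R | forall x y, `|f x - f y| <= `|x - y|]].

Definition is_Theta (R : realType) (a b : nat -> R) : Prop :=
  exists c C : R, [/\ 0 < c, c <= C &
    \forall n \near \oo, c * b n <= a n <= C * b n].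

(* Main.v *)
(* The number of copies of a tree is a sum of indicators [X a] over pairs [a] of
   a vertex set and an edge set, and [X a] only depends on the choices made by
   the edges of [a].  Hence [X a] and [X b] are independent when [a] and [b] have
   no common edge, and Stein's method for local dependence bounds the
   Wasserstein distance by [sigma^-3] times a sum over triples of dependent
   indicators.  Writing [N e] for the number of copies through the edge [e],
   AM-GM and Jensen bound this sum by a constant times [sum_e E (N e)^3], which
   also bounds the mean and the variance.  All the copies through [e] live in a
   ball of bounded radius, whose size is controlled by counting walks and hence
   by moments of the vertex degrees; these are of order [n] in total because
   [sum_v E b^(deg v)] is of order [n] for [b] close enough to 1.  For the lower
   bound on the mean, the vertices of the tree are ordered so that each one has
   exactly one earlier neighbour: each of the [C(n, t)] vertex sets of size [t]
   then carries an increasing copy with probability at least [n^-(t-1)]. *)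
Require Import Defs.
From mathcomp Require Import all_boot all_order all_algebra.
From mathcomp Require Import all_classical all_reals all_analysis.
From mathcomp Require Import measurable_realfun ring lra zify.
Import Order.TTheory GRing.Theory Num.Theory.
Import numFieldNormedType.Exports.
Set Implicit Arguments.
Unset Strict Implicit.
Unset Printing Implicit Defensive.

Local Open Scope classical_set_scope.
Local Open Scope ring_scope.

(** * Stein's equation for the normal distribution *)

(** The indicators are indexed by all potential copies, so their dependency graph has degrees
    growing with [n], and a bound through its maximal degree is useless. Third moments of the number
    of copies through an edge, summed over the edges, use only averages: the sum is of order [n],
    and dividing it by [sigma^3], of order [n^(3/2)], gives exactly [n^(-1/2)]. Copies are not
    induced, which is why the fate of a potential copy is decided by the choices of its own edges
    alone. For a Lipschitz test function the derivative of the Stein solution is Lipschitz but need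
    not be differentiable, so the solution and its derivative enter the local dependence argument
    only through a Lipschitz bound and a first-order Taylor bound, both with constant 7. The final
    constant may depend on [m] and [t] only: all bounds are uniform in the tree except the lower
    bound on the variance, and that one is made uniform because, up to relabelling, there are
    finitely many trees with [t] vertices. *)

Section derivative_rules.
Context {R : realType}.
Implicit Types (f g : R -> R) (x a b c : R).

Lemma is_derive1_eq {f x a b} :
  is_derive x (1 : R) f a -> a = b -> is_derive x (1 : R) f b.
Proof. by move=> + <-. Qed.

Lemma is_derive1_mul {f g x a b} :
  is_derive x (1 : R) f a -> is_derive x (1 : R) g b ->
  is_derive x (1 : R) (fun y : R => f y * g y) (a * g x + f x * b).
Proof.
move=> fa gb; have := is_deriveM fa gb; rewrite /GRing.scale/=.
by rewrite addrC [g x * a]mulrC.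
Qed.

Lemma is_derive1_add {f g x a b} :
  is_derive x (1 : R) f a -> is_derive x (1 : R) g b ->
  is_derive x (1 : R) (fun y : R => f y + g y) (a + b).
Proof. by move=> fa gb; have := is_deriveD fa gb. Qed.

Lemma is_derive1_sub {f g x a b} :
  is_derive x (1 : R) f a -> is_derive x (1 : R) g b ->
  is_derive x (1 : R) (fun y : R => f y - g y) (a - b).
Proof. by move=> fa gb; have := is_deriveB fa gb. Qed.

Lemma is_derive1_cst c x : is_derive x (1 : R) (fun _ : R => c) 0.
Proof. exact: is_derive_cst. Qed.

Lemma is_derive1_id x : is_derive x (1 : R) (fun y : R => y) 1.
Proof. exact: is_derive_id. Qed.

Lemma is_derive1_scale {f x a} c :
  is_derive x (1 : R) f a -> is_derive x (1 : R) (fun y : R => c * f y) (c * a).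
Proof. by move=> fa; have := is_deriveZ c fa. Qed.

Lemma is_derive1_div {f g x a b} : g x != 0 ->
  is_derive x (1 : R) f a -> is_derive x (1 : R) g b ->
  is_derive x (1 : R) (fun y : R => f y / g y) ((a * g x - f x * b) / g x ^+ 2).
Proof.
move=> gx0 fa gb.
have gV : is_derive x (1 : R) (fun y : R => (g y)^-1) _ := is_deriveV gx0 gb.
apply: (is_derive1_eq (is_derive1_mul fa gV)).
by rewrite /GRing.scale/=; field.
Qed.

Lemma is_derive1_sqr x : is_derive x (1 : R) (fun y : R => y ^+ 2) (2 * x).
Proof.
have := is_derive1_mul (is_derive1_id x) (is_derive1_id x).
by rewrite mul1r mulr1 mulr_natl mulr2n.
Qed.

Lemma is_derive_continuous {f g} : (forall x, is_derive x 1 f (g x)) ->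
  continuous f.
Proof.
by move=> fg x; apply: differentiable_continuous; apply/derivable1_diffP; have [] := fg x.
Qed.

Lemma le0_is_derive_nincr {f} {df : R -> R} {a b} :
  (forall x, is_derive x 1 f (df x)) -> (forall x, a <= x -> df x <= 0) ->
  a <= b -> f b <= f a.
Proof.
move=> dfE df0 ab; have [c cab|c] := MVT_segment ab (fun x _ => dfE x).
  by apply/continuous_subspaceT; exact: (is_derive_continuous dfE).
rewrite in_itv/= => /andP[ac _] fE.
by rewrite -subr_le0 fE mulr_le0_ge0 ?df0 ?subr_ge0.
Qed.

End derivative_rules.

Section gaussian.
Context {R : realType}.
Implicit Types (x y c : R) (G H B b : R -> R).

Lemma normal_pdf01E x : normal_pdf 0 1 x = normal_peak 1 * expR (- 2^-1 * x ^+ 2).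
Proof.
rewrite normal_pdfE ?oner_neq0//= /normal_fun subr0 expr1n.
by congr (_ * expR _); rewrite -(mulr_natl 1 2) mulr1 mulNr mulrC mulNr.
Qed.

Lemma normal_pdf01_gt0 x : 0 < normal_pdf 0 1 x.
Proof. by rewrite normal_pdf01E mulr_gt0 ?expR_gt0// normal_peak_gt0// oner_neq0. Qed.

Lemma is_derive_normal_pdf01 x :
  is_derive x (1 : R) (normal_pdf 0 1) (- x * normal_pdf 0 1 x).
Proof.
have -> : normal_pdf 0 1 = fun y : R => normal_peak 1 * expR (- 2^-1 * y ^+ 2).
  by apply/funext => y; rewrite normal_pdf01E.
have d2 := is_derive1_scale (- 2^-1) (is_derive1_sqr x).
have d3 := is_derive1_comp (is_derive_expR _) d2.
apply: (is_derive1_eq (is_derive1_scale (normal_peak 1) d3)).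
by rewrite /GRing.scale/=; field.
Qed.

Lemma normal_pdf01_cvgy : normal_pdf 0 1 x @[x --> +oo] --> (0 : R).
Proof.
(* From [(x - 1) ^+ 2 >= 0] one gets [- x ^+ 2 / 2 <= 1 / 2 - x], hence the factor [expR 2^-1] in
   front of [expR (- x)]. *)
pose k : R := normal_peak 1 * expR 2^-1.
apply: (@squeeze_cvgr _ _ _ _ (cst 0) (fun x : R => k * expR (- x))).
- apply: nearW => x /=; apply/andP; split; first exact/ltW/normal_pdf01_gt0.
  have k0 : 0 < normal_peak 1 :> R by rewrite normal_peak_gt0// oner_neq0.
  rewrite normal_pdf01E /k -(mulrA (normal_peak 1)) (ler_pM2l k0) -expRD ler_expR.
  by have := sqr_ge0 (x - 1 : R); rewrite sqrrB1; nra.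
- exact: cvg_cst.
- by rewrite -[X in _ --> X](mulr0 k); apply: cvgMr; exact: cvgr_expR.
Qed.

Lemma normal_pdf01_cvgn : normal_pdf 0 1 (n%:R : R) @[n --> \oo] --> (0 : R).
Proof. exact: (cvg_comp _ _ cvgr_idn normal_pdf01_cvgy). Qed.

(* With [phi] the normal density, [f = G / phi] solves [f' = H + x f]. *)
Lemma gaussian_comparison G H B b x0 (K : R) :
  (forall x, is_derive x 1 G (H x * normal_pdf 0 1 x)) ->
  (forall x, is_derive x 1 B (b x)) ->
  (forall x, x0 <= x -> b x - x * B x <= H x) ->
  (forall x, `|B x| <= K) ->
  G n%:R @[n --> \oo] --> (0 : R) ->
  G x0 <= B x0 * normal_pdf 0 1 x0.
Proof.
move=> dG dB bH BK G0.
(* [D] is [(B - f) * phi]: the density is the integrating factor that turns the differential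
   inequality into monotonicity. Non-increasing from [x0] on and tending to 0 along the integers,
   [D] is nonnegative at [x0]. *)
pose D x := B x * normal_pdf 0 1 x - G x.
have dD x : is_derive x 1 D
    ((b x - x * B x - H x) * normal_pdf 0 1 x).
  apply: is_derive1_eq.
    exact: (is_derive1_sub (is_derive1_mul (dB x) (is_derive_normal_pdf01 x)) (dG x)).
  by rewrite /=; ring.
have Dnincr y : x0 <= y -> D y <= D x0.
  move=> xy; apply: (le0_is_derive_nincr dD) => // z xz.
  by rewrite mulr_le0_ge0 ?subr_le0 ?bH// ltW ?normal_pdf01_gt0.
suff : 0 <= D x0 by rewrite subr_ge0.
have D0 : D n%:R @[n --> \oo] --> (0 : R).
  rewrite -(subr0 0); apply: cvgB => //.
  apply/norm_cvg0P.
  apply: (@squeeze_cvgr _ _ _ _ (cst 0) (fun n : nat => K * normal_pdf 0 1 (n%:R : R))).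
  - apply: nearW => n /=; rewrite normr_ge0 normrM [X in _ * X]ger0_norm ?normal_pdf_ge0//.
    by rewrite ler_wpM2r ?normal_pdf_ge0.
  - exact: cvg_cst.
  - by rewrite -[X in _ --> X](mulr0 K); apply: cvgM; [exact: cvg_cst|exact: normal_pdf01_cvgn].
apply: (ler_cvg_to D0 (cvg_cst (D x0))).
near=> n; apply: Dnincr; near: n; exact: nbhs_infty_ger.
Unshelve. all: by end_near. Qed.

End gaussian.

(** * Bounds on the solution of Stein's equation and on its derivative *)

Section stein_bound.
Context {R : realType}.
Implicit Types (x y c : R) (G H : R -> R).

(* Rational bounds, from below and above, on the Mills ratio
   [M y = (\int_y^oo phi) / phi y], which solves [M' - y M = -1]. *)
Let lo y : R := y / (1 + y ^+ 2).
Let hi y : R := (y + 2) / (1 + y + y ^+ 2).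

Let lo_den_gt0 y : 0 < 1 + y ^+ 2.
Proof. by rewrite ltr_pwDl// sqr_ge0. Qed.

Let hi_den_gt0 y : 0 < 1 + y + y ^+ 2.
Proof. by have := sqr_ge0 (y + 1/2); rewrite sqrrD; lra. Qed.

Let dlo y : is_derive y (1 : R) lo ((1 - y ^+ 2) / (1 + y ^+ 2) ^+ 2).
Proof.
have d0 : is_derive y (1 : R) (fun y : R => 1 + y ^+ 2) (0 + 2 * y).
  exact: (is_derive1_add (is_derive1_cst 1 y) (is_derive1_sqr y)).
apply: is_derive1_eq.
  by apply: (is_derive1_div _ (is_derive1_id y) d0); rewrite gt_eqF.
by rewrite /=; congr (_ / _); ring.
Qed.

Let dhi y : is_derive y (1 : R) hi (- (y ^+ 2 + 4 * y + 1) / (1 + y + y ^+ 2) ^+ 2).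
Proof.
have d0 : is_derive y (1 : R) (fun y : R => 1 + y + y ^+ 2) (0 + 1 + 2 * y).
  exact: (is_derive1_add (is_derive1_add (is_derive1_cst 1 y) (is_derive1_id y)) (is_derive1_sqr y)).
have d1 : is_derive y (1 : R) (fun y : R => y + 2) (1 + 0).
  exact: (is_derive1_add (is_derive1_id y) (is_derive1_cst 2 y)).
apply: is_derive1_eq.
  by apply: (is_derive1_div _ d1 d0); rewrite gt_eqF.
by rewrite /=; congr (_ / _); ring.
Qed.

Let lo_ode y : -1 <= (1 - y ^+ 2) / (1 + y ^+ 2) ^+ 2 - y * lo y.
Proof.
rewrite -subr_ge0 /lo; have d0 := lo_den_gt0 y.
have -> : (1 - y ^+ 2) / (1 + y ^+ 2) ^+ 2 - y * (y / (1 + y ^+ 2)) - -1 =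
  2 / (1 + y ^+ 2) ^+ 2.
  by field; rewrite gt_eqF.
by rewrite divr_ge0// sqr_ge0.
Qed.

Let hi_ode y : 0 <= y ->
  - (y ^+ 2 + 4 * y + 1) / (1 + y + y ^+ 2) ^+ 2 - y * hi y <= -1.
Proof.
move=> y0; rewrite -subr_le0 /hi; have d0 := hi_den_gt0 y.
have -> : - (y ^+ 2 + 4 * y + 1) / (1 + y + y ^+ 2) ^+ 2
    - y * ((y + 2) / (1 + y + y ^+ 2)) - -1 =
  - (y ^+ 2 + 4 * y + y ^+ 3) / (1 + y + y ^+ 2) ^+ 2.
  by field; rewrite gt_eqF.
rewrite mulNr oppr_le0 divr_ge0 ?sqr_ge0//.
by rewrite !addr_ge0 ?exprn_ge0// mulr_ge0.
Qed.

Let lo_bnd y : `|lo y| <= 1.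
Proof.
have d0 := lo_den_gt0 y; rewrite /lo ler_norml ler_pdivrMr// ler_pdivlMr//.
have := sqr_ge0 (y + 1); have := sqr_ge0 (y - 1); rewrite sqrrB sqrrD.
by move=> *; apply/andP; split; nra.
Qed.

Let hi_bnd y : `|hi y| <= 4.
Proof.
have d0 := hi_den_gt0 y; rewrite /hi ler_norml ler_pdivrMr// ler_pdivlMr//.
have := sqr_ge0 (y + 5/8); have := sqr_ge0 (y + 3/8).
by move=> *; apply/andP; split; nra.
Qed.

(* For [y >= x0] the Lipschitz condition gives [H y >= c - y] with
   [c = H x0 + x0], and [B = 1 - c V] is a subsolution of [B' - y B = c - y] for
   [V = lo] or [V = hi] according to the sign of [c]. *)
Lemma stein_upper_bound G H x0 : 0 <= x0 ->
  (forall x, is_derive x 1 G (H x * normal_pdf 0 1 x)) ->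
  (forall x y, `|H x - H y| <= `|x - y|) ->
  (forall x, `|H x| <= `|x| + 1) ->
  G n%:R @[n --> \oo] --> (0 : R) ->
  G x0 / normal_pdf 0 1 x0 <= 3 /\
  x0 * (H x0 + x0 * (G x0 / normal_pdf 0 1 x0)) <= 3.
Proof.
move=> x00 dG HL H1 G0; pose c := H x0 + x0.
have Hx0 : - (x0 + 1) <= H x0 <= x0 + 1.
  by rewrite -ler_norml (le_trans (H1 _))// ger0_norm.
have Hge x : x0 <= x -> c - x <= H x.
  move=> xx0; have := HL x x0; rewrite ler_norml => /andP[].
  by rewrite ger0_norm ?subr_ge0// /c; lra.
pose f := G x0 / normal_pdf 0 1 x0.
have p0 := normal_pdf01_gt0 x0.
rewrite -/f; have [c0|c0] := leP 0 c.
  have fle : f <= 1 - c * lo x0.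
    rewrite ler_pdivrMr//.
    pose B (x : R) : R := 1 - c * lo x.
    pose b (y : R) : R := 0 - c * ((1 - y ^+ 2) / (1 + y ^+ 2) ^+ 2).
    suff [dB bH BK] : [/\ forall x, is_derive x (1 : R) B (b x),
        forall x, x0 <= x -> b x - x * B x <= H x & forall x, `|B x| <= 1 + `|c|].
      exact: (gaussian_comparison dG dB bH BK G0).
    split.
    - move=> x; exact: (is_derive1_sub (is_derive1_cst 1 x) (is_derive1_scale c (dlo x))).
    - move=> x xx0; apply: le_trans (Hge _ xx0).
      by have := ler_wpM2l c0 (lo_ode x); rewrite /B /b; lra.
    - move=> x; rewrite (le_trans (ler_normB _ _))// normr1 lerD2l normrM.
      by rewrite ler_piMr.
  have d0 := lo_den_gt0 x0.
  have lo0 : 0 <= lo x0 by rewrite divr_ge0// ltW.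
  have -> : H x0 = c - x0 by rewrite /c addrK.
  split; first by have := mulr_ge0 c0 lo0; lra.
  have c1 : c <= 2 * x0 + 1 by rewrite /c; lra.
  apply: (@le_trans _ _ (x0 * (c - x0 + x0 * (1 - c * lo x0)))).
    by rewrite ler_wpM2l// lerD2l ler_wpM2l.
  have -> : x0 * (c - x0 + x0 * (1 - c * lo x0)) = c * x0 / (1 + x0 ^+ 2).
    by rewrite /lo; field; rewrite gt_eqF.
  rewrite ler_pdivrMr//; have := ler_wpM2r x00 c1; have := sqr_ge0 (x0 - 1/2).
  by rewrite sqrrB; nra.
have fle : f <= 1 - c * hi x0.
  rewrite ler_pdivrMr//.
  pose B (x : R) : R := 1 - c * hi x.
  pose b (y : R) : R := 0 - c * (- (y ^+ 2 + 4 * y + 1) / (1 + y + y ^+ 2) ^+ 2).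
  suff [dB bH BK] : [/\ forall x, is_derive x (1 : R) B (b x),
      forall x, x0 <= x -> b x - x * B x <= H x & forall x, `|B x| <= 1 + `|c| * 4].
    exact: (gaussian_comparison dG dB bH BK G0).
  split.
  - move=> x; exact: (is_derive1_sub (is_derive1_cst 1 x) (is_derive1_scale c (dhi x))).
  - move=> x xx0; apply: le_trans (Hge _ xx0).
    have c0' : 0 <= - c by lra.
    by have := ler_wpM2l c0' (hi_ode (le_trans x00 xx0)); rewrite /B /b; lra.
  - move=> x; rewrite (le_trans (ler_normB _ _))// normr1 lerD2l normrM.
    by rewrite ler_wpM2l.
have d0 := hi_den_gt0 x0.
have hi0 : 0 <= hi x0 by rewrite divr_ge0 ?addr_ge0 ?sqr_ge0.
have hi2 : hi x0 <= 2.
  by rewrite ler_pdivrMr//; have := sqr_ge0 x0; nra.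
have c1 : -1 <= c by rewrite /c; lra.
have -> : H x0 = c - x0 by rewrite /c addrK.
split; first by nra.
apply: (@le_trans _ _ (x0 * (c - x0 + x0 * (1 - c * hi x0)))).
  by rewrite ler_wpM2l// lerD2l ler_wpM2l.
have -> : x0 * (c - x0 + x0 * (1 - c * hi x0)) = - c * (x0 * (x0 - 1) / (1 + x0 + x0 ^+ 2)).
  by rewrite /hi; field; rewrite gt_eqF.
have z1 : x0 * (x0 - 1) / (1 + x0 + x0 ^+ 2) <= 1.
  by rewrite ler_pdivrMr//; nra.
have c0' : 0 <= - c by lra.
by have := ler_wpM2l c0' z1; lra.
Qed.

End stein_bound.


Section stein_derivative.
Context {R : realType}.
Variables (G H : R -> R).
Hypothesis dG : forall x : R, is_derive x (1 : R) G (H x * normal_pdf 0 1 x).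
Hypothesis HL : forall x y, `|H x - H y| <= `|x - y|.
Hypothesis H1 : forall x, `|H x| <= `|x| + 1.
Hypothesis Gy : G n%:R @[n --> \oo] --> (0 : R).

Let f x := G x / normal_pdf 0 1 x.
Let g x := H x + x * f x.

(** The equation is linear, so the lower bounds are the upper bounds for the data [- G] and
    [- H]. *)
Lemma stein_solution_bound_ge0 x : 0 <= x -> `|f x| <= 3 /\ `|x * g x| <= 3.
Proof.
move=> x0; have [u1 u2] := stein_upper_bound x0 dG HL H1 Gy.
have dGN y : is_derive y (1 : R) (fun y => -1 * G y) (- H y * normal_pdf 0 1 y).
  by apply: (is_derive1_eq (is_derive1_scale (-1) (dG y))); rewrite mulN1r mulNr.
have [|||v1 v2] := @stein_upper_bound _ (fun y => -1 * G y) (fun y => - H y) x x0 dGN.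
- by move=> y z; rewrite -opprD normrN.
- by move=> y; rewrite normrN.
- by rewrite -[X in _ --> X](mulr0 (-1)); apply: cvgM => //; exact: cvg_cst.
rewrite !ler_norml; split; apply/andP; split => //.
- by move: v1; rewrite mulN1r mulNr -/(f x); lra.
- by move: v2; rewrite mulN1r mulNr -/(f x) /g; lra.
Qed.

End stein_derivative.

Section stein_equation_bound.
Context {R : realType}.
Variables (G H : R -> R).
Hypothesis dG : forall x : R, is_derive x (1 : R) G (H x * normal_pdf 0 1 x).
Hypothesis HL : forall x y, `|H x - H y| <= `|x - y|.
Hypothesis H1 : forall x, `|H x| <= `|x| + 1.
Hypothesis Gy : G n%:R @[n --> \oo] --> (0 : R).
Hypothesis GNy : G (- n%:R) @[n --> \oo] --> (0 : R).

Let f x := G x / normal_pdf 0 1 x.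
Let g x := H x + x * f x.

(** Negative arguments are reflected: the data [- G (- y)] and [H (- y)] satisfy the same hypotheses
    and turn [f x] into [- f x] and [x * g x] into its opposite. This uses the decay of [G] at minus
    infinity. *)
Lemma stein_solution_bound x : `|f x| <= 3 /\ `|x * g x| <= 3.
Proof.
have [x0|x0] := leP 0 x.
  exact: (stein_solution_bound_ge0 dG HL H1 Gy).
have dGN y : is_derive y (1 : R) (fun y => -1 * G (- y)) (H (- y) * normal_pdf 0 1 y).
  have d := is_derive1_comp (dG (- y)) (is_deriveNid y (1 : R)).
  apply: (is_derive1_eq (is_derive1_scale (-1) d)).
  by rewrite !normal_pdf01E sqrrN; ring.
have Nx0 : 0 <= - x by lra.
have [||| f3 g3] := @stein_solution_bound_ge0 _ _ _ dGN _ _ _ _ Nx0.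
- by move=> y z; rewrite (le_trans (HL _ _))// -opprD normrN.
- by move=> y; rewrite (le_trans (H1 _))// normrN.
- by rewrite -[X in _ --> X](mulr0 (-1)); apply: cvgM => //; exact: cvg_cst.
move: f3 g3; rewrite opprK; have -> : -1 * G x / normal_pdf 0 1 (- x) = - f x.
  by rewrite /f !normal_pdf01E sqrrN mulN1r mulNr.
by rewrite normrN mulrNN mulNr normrN.
Qed.

Lemma stein_solution_derive x : is_derive x (1 : R) f (g x).
Proof.
have p0 : normal_pdf 0 1 x != 0 :> R by rewrite gt_eqF ?normal_pdf01_gt0.
apply: (is_derive1_eq (is_derive1_div p0 (dG x) (is_derive_normal_pdf01 x))).
by rewrite /g /f; field.
Qed.

(** In [g = H + x * f] the first term is 1-Lipschitz, and the second has derivative [f + x * g],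
    bounded by [3 + 3]; whence 7. *)
Lemma stein_solution_lipschitz x y : `|g x - g y| <= 7 * `|x - y|.
Proof.
have dxf z : is_derive z (1 : R) (fun z => z * f z) (1 * f z + z * g z).
  exact: (is_derive1_mul (is_derive1_id z) (stein_solution_derive z)).
wlog xy : x y / x <= y.
  by move=> W; have [/W//|/ltW/W] := leP x y; rewrite distrC [`|y - x|]distrC.
have [|c _ E] := MVT_segment xy (fun z _ => dxf z).
  by apply: continuous_subspaceT; exact: (is_derive_continuous dxf).
rewrite distrC [`|x - y|]distrC /g.
have -> : H y + y * f y - (H x + x * f x) = H y - H x + (y * f y - x * f x) by ring.
have [f3 g3] := stein_solution_bound c.
rewrite E (le_trans (ler_normD _ _))//.
have -> : 7 * `|y - x| = `|y - x| + 6 * `|y - x| by ring.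
rewrite lerD// normrM ler_wpM2r// mul1r.
by rewrite (le_trans (ler_normD _ _))//; lra.
Qed.

(** The mean value theorem gives [f y - f x = g c * (y - x)] with [c] between [x] and [y], and [g c]
    is then compared with [g x]. *)
Lemma stein_solution_taylor x y : `|f y - f x - g x * (y - x)| <= 7 * `|y - x| ^+ 2.
Proof.
suff [c [cx E]] : exists c, `|c - x| <= `|y - x| /\ f y - f x = g c * (y - x).
  rewrite E -mulrBl normrM expr2 mulrA ler_wpM2r//.
  by rewrite (le_trans (stein_solution_lipschitz _ _))// ler_wpM2l.
have cf := is_derive_continuous stein_solution_derive.
have [xy|/ltW yx] := leP x y.
  have [|c] := MVT_segment xy (fun z _ => stein_solution_derive z).
    exact: continuous_subspaceT.
  rewrite in_itv/= => /andP[xc cy] E; exists c; split => //.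
  by rewrite !ger0_norm ?subr_ge0 ?lerD2r.
have [|c] := MVT_segment yx (fun z _ => stein_solution_derive z).
  exact: continuous_subspaceT.
rewrite in_itv/= => /andP[yc cx] E; exists c; split.
  by rewrite !ler0_norm ?subr_le0// lerN2 lerD2r.
by rewrite -[y - x]opprB mulrN -E opprB.
Qed.

End stein_equation_bound.

(** * Normal integrals and Stein's equation for Lipschitz functions *)

Section normal_expectation.
Context {R : realType}.
Local Notation mu := (@lebesgue_measure R).
Implicit Types (x y : R) (h : R -> R).

Lemma integral_normal_prob (f : measurableTypeR R -> \bar R) :
  (normal_prob (0 : R) 1).-integrable [set: _] f ->
  (\int[normal_prob (0 : R) 1]_x f x = \int[mu]_x (f x * (normal_pdf 0 1 x)%:E))%E.
Proof.
move=> intf.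
rewrite -(Radon_Nikodym_change_of_variables (normal_prob_dominates 0 1))//=.
have mf := measurable_int _ intf.
apply: ae_eq_integral => //.
- apply: emeasurable_funM => //; apply: (measurable_int mu).
  by apply: Radon_Nikodym_integrable; exact: normal_prob_dominates.
- apply: emeasurable_funM => //=; apply/measurable_EFinP; exact: measurable_normal_pdf.
- apply: ae_eqe_mul2l => /=.
  rewrite Radon_NikodymE//=; first exact: normal_prob_dominates.
  move=> abmu.
  case: cid => /= h [h1 h2 h3].
  apply: integral_ae_eq => //=.
  + by apply/measurable_EFinP; exact: measurable_normal_pdf.
  + by move=> E E01 mE; rewrite -h3.
Qed.

(** The nonnegative version serves to prove the integrability that [integral_normal_prob]
    requires. *)
Lemma ge0_integral_normal_prob (f : measurableTypeR R -> \bar R) :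
  (forall x, (0 <= f x)%E) -> measurable_fun [set: measurableTypeR R] f ->
  (\int[normal_prob (0 : R) 1]_x f x = \int[mu]_x (f x * (normal_pdf 0 1 x)%:E))%E.
Proof.
move=> f0 mf; have np := normal_prob_dominates (0 : R) 1.
have fi := Radon_Nikodym_SigmaFinite.f_integrable np.
rewrite -(Radon_Nikodym_SigmaFinite.change_of_variables np f0 measurableT mf).
apply: ae_eq_integral => //.
- by apply: emeasurable_funM => //; exact: measurable_int fi.
- apply: emeasurable_funM => //=; apply/measurable_EFinP; exact: measurable_normal_pdf.
- apply: ae_eqe_mul2l => /=; apply: integral_ae_eq => //=.
  + by apply/measurable_EFinP; exact: measurable_normal_pdf.
  + by move=> E E01 mE; rewrite -(Radon_Nikodym_SigmaFinite.f_integral np mE).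
Qed.

(** By symmetry this is twice the integral over the half-line, where the opposite of the density is
    an antiderivative of [x * normal_pdf 0 1 x]. *)
Lemma integral_norm_normal_pdf :
  (\int[mu]_x (`|x| * normal_pdf 0 1 x)%:E = (2 * normal_pdf 0 1 (0 : R))%:E)%E.
Proof.
have cp : continuous (normal_pdf (0 : R) 1) by apply: continuous_normal_pdf; rewrite oner_neq0.
rewrite ge0_symfun_integralT.
- rewrite -set_itvcy.
  transitivity (2%:E * \int[mu]_(x in `[(0:R)%R, +oo[) (x * normal_pdf 0 1 x)%:E)%E.
    congr (_ * _)%E; apply: eq_integral => x; rewrite inE/= in_itv/= andbT => x0.
    by rewrite ger0_norm.
  have d x : is_derive x (1 : R) (fun y : R => -1 * normal_pdf 0 1 y) (x * normal_pdf 0 1 x).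
    apply: (is_derive1_eq (is_derive1_scale (-1) (is_derive_normal_pdf01 x))).
    by rewrite mulN1r mulNr opprK.
  rewrite (@ge0_continuous_FTC2y _ _ (fun y : R => -1 * normal_pdf 0 1 y) 0 0).
  + by rewrite mulN1r -EFinB sub0r opprK EFinM.
  + by move=> x x0; rewrite mulr_ge0 ?normal_pdf_ge0.
  + apply/continuous_subspaceT => x; apply: cvgM; [exact: cvg_id|exact: cp].
  + by rewrite -[X in _ --> X](mulr0 (-1)); apply: cvgM; [exact: cvg_cst|exact: normal_pdf01_cvgy].
  + by move=> x _; have [] := d x.
  + apply: cvg_at_right_filter; apply: cvgM; [exact: cvg_cst|exact: cp].
  + by move=> x _; rewrite derive1E; have [_ ->] := d x.
- by move=> x; rewrite mulr_ge0// normal_pdf_ge0.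
- by move=> x; apply: cvgM; [exact: norm_continuous|exact: cp].
- by move=> x; rewrite /= normrN !normal_pdf01E sqrrN.
Qed.

Lemma lipschitz1_continuous h : (forall x y, `|h x - h y| <= `|x - y|) -> continuous h.
Proof.
move=> hL x; apply/cvgrPdist_le => e e0.
near=> y; apply: (le_trans (hL _ _)).
by near: y; apply: cvgr_dist_le.
Unshelve. all: by end_near. Qed.


Lemma integrable_norm_normal_pdf :
  mu.-integrable [set: R] (fun x => (`|x| * normal_pdf 0 1 x)%:E).
Proof.
apply/integrableP; split.
  apply/measurable_EFinP; apply: measurable_funM.
    by apply: continuous_measurable_fun; exact: norm_continuous.
  exact: measurable_normal_pdf.
under eq_integral => x _.
  rewrite gee0_abs; last by rewrite lee_fin mulr_ge0// normal_pdf_ge0.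
  over.
by rewrite integral_norm_normal_pdf ltry.
Qed.

Section lipschitz.
Variable h : R -> R.
Hypothesis hL : forall x y, `|h x - h y| <= `|x - y|.

Let mh : measurable_fun [set: R] h.
Proof. by apply: continuous_measurable_fun; exact: lipschitz1_continuous. Qed.

Lemma integrable_lipschitz_normal_pdf :
  mu.-integrable [set: R] (fun x => (h x * normal_pdf 0 1 x)%:E).
Proof.
apply: (@le_integrable _ _ _ mu _ measurableT _
  (fun x => (`|h 0|%:E * (normal_pdf 0 1 x)%:E + (`|x| * normal_pdf 0 1 x)%:E)%E)).
- by apply/measurable_EFinP; apply: measurable_funM => //; exact: measurable_normal_pdf.
- move=> x _; rewrite -EFinM -EFinD !abse_EFin lee_fin -mulrDl !normrM.
  rewrite (ger0_norm (normal_pdf_ge0 0 1 x)) ler_wpM2r ?normal_pdf_ge0//.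
  rewrite [leRHS]ger0_norm ?addr_ge0// -[h x](subrK (h 0)) addrC.
  by rewrite (le_trans (ler_normD _ _))// lerD2l (le_trans (hL _ _))// subr0.
- apply: integrableD => //; last exact: integrable_norm_normal_pdf.
  by apply: integrableZl => //; exact: integrable_normal_pdf.
Qed.

Definition normal_mean : R := \int[mu]_x (h x * normal_pdf 0 1 x).

Lemma integral_normal_prob_lipschitz :
  (\int[normal_prob (0 : R) 1]_x (h x)%:E = normal_mean%:E)%E.
Proof.
rewrite integral_normal_prob.
  rewrite /normal_mean /Rintegral fineK.
    by apply: eq_integral => x _; rewrite EFinM.
  by apply: integrable_fin_num => //; exact: integrable_lipschitz_normal_pdf.
apply/integrableP; split; first by apply/measurable_EFinP; exact: mh.
rewrite ge0_integral_normal_prob//; last first.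
  by apply: measurableT_comp => //; apply/measurable_EFinP; exact: mh.
have /integrableP[_] := integrable_lipschitz_normal_pdf.
congr (_ < _)%E; apply: eq_integral => x _.
by rewrite EFinM abseM [X in (_ * X)%E]gee0_abs// lee_fin normal_pdf_ge0.
Qed.

Let c := normal_mean.
Let H x := h x - c.
Let Hphi x := H x * normal_pdf 0 1 x.

Let HL x y : `|H x - H y| <= `|x - y|.
Proof. by rewrite /H opprB addrA subrK. Qed.

Let cphi : continuous (normal_pdf (0 : R) 1).
Proof. by apply: continuous_normal_pdf; rewrite oner_neq0. Qed.

Let cHphi : continuous Hphi.
Proof. by move=> x; apply: cvgM; [exact: lipschitz1_continuous|exact: cphi]. Qed.

Let int_Hphi : mu.-integrable [set: R] (EFin \o Hphi).
Proof.
have iB := integrableB measurableT integrable_lipschitz_normal_pdf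
  (integrableZl measurableT c (integrable_normal_pdf 0 1)).
by move: iB; apply: eq_integrable => // x _; rewrite /= /Hphi /H mulrBl.
Qed.

Let integral_Hphi : (\int[mu]_x (Hphi x)%:E = 0)%E.
Proof.
transitivity (\int[mu]_x ((h x * normal_pdf 0 1 x)%:E - c%:E * (normal_pdf 0 1 x)%:E))%E.
  by apply: eq_integral => x _; rewrite -EFinM -EFinB /Hphi /H mulrBl.
have i1 := integrable_normal_pdf (0 : R) 1.
rewrite integralB//; [|exact: integrable_lipschitz_normal_pdf|exact: integrableZl].
rewrite integralZl// integral_normal_pdf mule1 /c /normal_mean /Rintegral fineK ?subee//.
  by apply: integrable_fin_num => //; exact: integrable_lipschitz_normal_pdf.
by apply: integrable_fin_num => //; exact: integrable_lipschitz_normal_pdf.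
Qed.

(** [H x] is the normal average of [h x - h y] over [y], hence at most [|x|] plus the mean of [|y|].
    That mean is [2 / sqrt (2 pi)], which is at most 1 because [pi >= 2]. *)
Let H1 x : `|H x| <= `|x| + 1.
Proof.
pose g y := `|x - y| * normal_pdf 0 1 y.
have i1 := integrable_normal_pdf (0 : R) 1.
have i2 := integrable_norm_normal_pdf.
have xL y z : `|(h x - h y) - (h x - h z)| <= `|y - z|.
  by rewrite opprB addrC addrA subrK distrC.
have E : H x = \int[mu]_y ((h x - h y) * normal_pdf 0 1 y).
  under eq_Rintegral do rewrite mulrBl.
  rewrite RintegralB//; last 2 first.
  - by apply: (integrableZl measurableT (h x) i1).
  - exact: integrable_lipschitz_normal_pdf.
  rewrite RintegralZl//.
  by rewrite [X in _ * X](_ : _ = 1) ?mulr1// /Rintegral integral_normal_pdf.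
have iL : mu.-integrable [set: R] (EFin \o (fun y => (h x - h y) * normal_pdf 0 1 y)).
  have := integrableB measurableT (integrableZl measurableT (h x) i1) integrable_lipschitz_normal_pdf.
  by apply: eq_integrable => // y _; rewrite /= -EFinM -EFinB mulrBl.
rewrite E (le_trans (le_normr_Rintegral measurableT iL))//.
apply: (@le_trans _ _ (\int[mu]_y (`|x| * normal_pdf 0 1 y + `|y| * normal_pdf 0 1 y))).
  apply: le_Rintegral => //.
  - exact: integrable_norm.
  - exact: (integrableD measurableT (integrableZl measurableT `|x| i1) i2).
  - move=> y _; rewrite normrM (ger0_norm (normal_pdf_ge0 0 1 y)) -mulrDl.
    rewrite ler_wpM2r ?normal_pdf_ge0// (le_trans (hL _ _))//.
    by rewrite (le_trans (ler_normB _ _)).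
rewrite RintegralD//; last exact: (integrableZl measurableT `|x| i1).
rewrite RintegralZl// [X in _ * X + _](_ : _ = 1) ?mulr1; last first.
  by rewrite /Rintegral integral_normal_pdf.
rewrite lerD2l /Rintegral integral_norm_normal_pdf/= normal_pdf01E expr0n/= mulr0 expR0 mulr1.
rewrite /normal_peak expr1n mul1r ler_pdivrMr ?mul1r; last first.
  by rewrite sqrtr_gt0 mulrn_wgt0// pi_gt0.
rewrite -[2%R]ger0_norm// -sqrtr_sqr ler_wsqrtr//.
by have := pi_ge2 R; rewrite -mulr_natr; nra.
Qed.

(** Divided by the density, this is the classical solution of Stein's equation. Centring [h] makes
    the total integral of [Hphi] vanish, so that [G] decays at both ends. *)
Let G x := \int[mu]_(y in `]-oo, x]) Hphi y.

Let dG x : is_derive x (1 : R) G (Hphi x).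
Proof.
have xx : x < x + 1 by rewrite ltrDl.
have iS : mu.-integrable [set` Interval -oo%O (BRight (x + 1))] (EFin \o Hphi).
  exact: (integrableS measurableT _ _ int_Hphi).
have [d dE] := continuous_FTC1 xx iS (ltNyr _) (@cHphi x).
apply: DeriveDef; first exact: d.
by rewrite -derive1E; exact: dE.
Qed.

(** Dominated convergence; [A] is the whole line when [a n = n] and empty when [a n = - n]. *)
Let G_cvg (a : nat -> R) (A : set R) : measurable A ->
  (forall y, \forall n \near \oo, (y <= a n) = (y \in A)) ->
  G (a n) @[n --> \oo] --> fine (\int[mu]_(y in A) (Hphi y)%:E)%E.
Proof.
move=> mA aA.
have mHphi : measurable_fun [set: R] (EFin \o Hphi) by exact: measurable_int int_Hphi.
pose u n := (EFin \o Hphi) \_ [set` `]-oo, a n]].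
have mu_ n : measurable_fun [set: R] (u n).
  by apply/(measurable_restrictT _ _).1 => //; exact: measurable_funTS.
have mA_ : measurable_fun [set: R] ((EFin \o Hphi) \_ A).
  by apply/(measurable_restrictT _ _).1 => //; exact: measurable_funTS.
have [||||| _ _ cvg] := @dominated_convergence _ _ _ mu setT measurableT u
  ((EFin \o Hphi) \_ A) (fun y => `|(EFin \o Hphi) y|%E).
- exact: mu_.
- exact: mA_.
- apply: aeW => y _; apply: cvg_near_cst.
  have := aA y; apply: filterS => n yn.
  rewrite /u !patchE -yn; congr (if _ then _ else _).
  by apply/idP/idP; rewrite inE/= in_itv.
- exact: integrable_abse.
- by apply: aeW => y n _; rewrite /u patchE; case: ifPn; rewrite ?abse0 ?abse_ge0.
rewrite /G /Rintegral integral_mkcond.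
have -> : (fun n => fine (\int[mu]_(x in `]-oo, a n]) (EFin \o Hphi) x)%E) =
    (fun n => fine (\int[mu]_x u n x)%E).
  by apply/funext => n; rewrite integral_mkcond.
apply: fine_cvg; rewrite fineK; first exact: cvg.
rewrite -integral_mkcond; apply: integrable_fin_num => //.
exact: integrableS int_Hphi.
Qed.

Let Gy : G n%:R @[n --> \oo] --> (0 : R).
Proof.
have := @G_cvg (fun n => n%:R) setT measurableT _.
rewrite integral_Hphi; apply => y.
near=> n; rewrite in_setT; near: n; exact: nbhs_infty_ger.
Unshelve. all: by end_near. Qed.

Let GNy : G (- n%:R) @[n --> \oo] --> (0 : R).
Proof.
have := @G_cvg (fun n => - n%:R) set0 measurable0 _.
rewrite integral_set0; apply => y.
near=> n; rewrite in_set0; apply/negbTE; rewrite -ltNge ltrNl.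
near: n; exact: nbhs_infty_gtr.
Unshelve. all: by end_near. Qed.

(** [g] is the derivative of [f]; only the properties consumed by [local_dependence_stein] are
    exported, and they mention no derivative. *)
Lemma stein_equation : exists f g : R -> R,
  [/\ forall x, h x - normal_mean = g x - x * f x,
      forall x y, `|g x - g y| <= 7 * `|x - y| &
      forall x y, `|f y - f x - g x * (y - x)| <= 7 * `|y - x| ^+ 2].
Proof.
exists (fun x => G x / normal_pdf 0 1 x), (fun x => H x + x * (G x / normal_pdf 0 1 x)).
split.
- by move=> x; rewrite addrK.
- exact: (stein_solution_lipschitz dG HL H1 Gy GNy).
- exact: (stein_solution_taylor dG HL H1 Gy GNy).
Qed.

End lipschitz.

End normal_expectation.

(** * Expectations over the attachment choices *)

Section expectation.
Context {R : realType} {m n : nat}.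
Implicit Types (f g : outcome m n -> R) (F : {set edge m n}) (w : outcome m n).

(** A finite sum, free of integrability conditions; [integral_attach_prob] identifies it with the
    integral against [attach_prob]. *)
Definition Ex g : R := \sum_w attach_pmf R w * g w.

Lemma eq_Ex f g : f =1 g -> Ex f = Ex g.
Proof. by move=> fg; apply: eq_bigr => w _; rewrite fg. Qed.

Lemma Ex_cst (c : R) : Ex (fun=> c) = c.
Proof. by rewrite /Ex -mulr_suml attach_pmf_sum1 mul1r. Qed.

Lemma ExD f g : Ex (fun w => f w + g w) = Ex f + Ex g.
Proof. by rewrite /Ex -big_split; apply: eq_bigr => w _; rewrite mulrDr. Qed.

Lemma ExZ (c : R) g : Ex (fun w => c * g w) = c * Ex g.
Proof. by rewrite /Ex mulr_sumr; apply: eq_bigr => w _; rewrite mulrCA. Qed.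

Lemma ExN g : Ex (fun w => - g w) = - Ex g.
Proof. by rewrite /Ex -sumrN; apply: eq_bigr => w _; rewrite mulrN. Qed.

Lemma ExB f g : Ex (fun w => f w - g w) = Ex f - Ex g.
Proof. by rewrite ExD ExN. Qed.

Lemma Ex_sum (I : Type) (r : seq I) (P : pred I) (X : I -> outcome m n -> R) :
  Ex (fun w => \sum_(i <- r | P i) X i w) = \sum_(i <- r | P i) Ex (X i).
Proof. by rewrite /Ex exchange_big; apply: eq_bigr => w _; rewrite mulr_sumr. Qed.

Lemma le_Ex f g : (forall w, f w <= g w) -> Ex f <= Ex g.
Proof. by move=> fg; apply: ler_sum => w _; rewrite ler_wpM2l ?attach_pmf_ge0. Qed.

Lemma Ex_ge0 g : (forall w, 0 <= g w) -> 0 <= Ex g.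
Proof. by move=> g0; apply: sumr_ge0 => w _; rewrite mulr_ge0 ?attach_pmf_ge0. Qed.

Lemma ler_norm_Ex g : `|Ex g| <= Ex (fun w => `|g w|).
Proof.
rewrite (le_trans (ler_norm_sum _ _ _))// ler_sum// => w _.
by rewrite normrM ger0_norm ?attach_pmf_ge0.
Qed.

(** Measurability with respect to the coordinates in [F], phrased pointwise. *)
Definition determined F (T : Type) (g : outcome m n -> T) : Prop :=
  forall w w', (forall e, e \in F -> w e = w' e) -> g w = g w'.

Lemma determinedS F F' (T : Type) (g : outcome m n -> T) :
  F \subset F' -> determined F g -> determined F' g.
Proof. by move=> /fintype.subsetP FF' gF w w' ww'; apply: gF => e /FF'/ww'. Qed.

Lemma determined_comp F (T T' : Type) (g : outcome m n -> T) (h : T -> T') :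
  determined F g -> determined F (fun w => h (g w)).
Proof. by move=> gF w w' /gF ->. Qed.

Lemma determined_sum F (I : finType) (P : pred I) (X : I -> outcome m n -> R) :
  (forall i, P i -> determined F (X i)) ->
  determined F (fun w => \sum_(i | P i) X i w).
Proof. by move=> XF w w' ww'; apply: eq_bigr => i /XF; apply. Qed.

Lemma determined_mul F f g : determined F f -> determined F g ->
  determined F (fun w => f w * g w).
Proof. by move=> fF gF w w' ww'; rewrite (fF _ _ ww') (gF _ _ ww'). Qed.

(* Swapping the coordinates in [F] between two independent outcomes preserves
   their joint (uniform) law. *)
Lemma Ex_indep F f g : determined F f -> determined (~: F) g ->
  Ex (fun w => f w * g w) = Ex f * Ex g.
Proof.
move=> fF gF.
pose mix (w w' : outcome m n) : outcome m n :=
  finfun (fun e : edge m n => if e \in F then w e else w' e).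
have mixE w w' e : mix w w' e = if e \in F then w e else w' e by rewrite ffunE.
pose sw (p : outcome m n * outcome m n) := (mix p.1 p.2, mix p.2 p.1).
have swK : involutive sw.
  by move=> [w w']; congr pair; apply/ffunP => e; rewrite !mixE/=; case: ifP => eF; rewrite ?mixE eF.
have pE w w' : attach_pmf R w = attach_pmf R w' by [].
pose w0 : outcome m n := point; pose p := attach_pmf R w0.
have -> : Ex f * Ex g = \sum_(q : outcome m n * outcome m n) p ^+ 2 * (f q.1 * g q.2).
  rewrite /Ex big_distrlr/= pair_big/=; apply: eq_bigr => -[w w'] _ /=.
  by rewrite !(pE _ w0) -/p; ring.
rewrite (reindex_inj (inv_inj swK))/=.
have fE w w' : f (mix w w') = f w by apply: fF => e eF; rewrite mixE eF.
have gE w w' : g (mix w' w) = g w.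
  by apply: gF => e; rewrite inE => /negbTE eF; rewrite mixE eF.
transitivity (\sum_(q : outcome m n * outcome m n) p ^+ 2 * (f q.1 * g q.1)); last first.
  by apply: eq_bigr => -[w w'] _ /=; rewrite fE gE.
rewrite -(pair_big xpredT xpredT (fun w _ => p ^+ 2 * (f w * g w)))/=.
apply: eq_bigr => w _; rewrite -mulr_sumr.
have -> : p ^+ 2 * \sum_(i : outcome m n) f w * g w =
    (\sum_(j : outcome m n) attach_pmf R j) * (p * (f w * g w)).
  by rewrite mulr_suml mulr_sumr; apply: eq_bigr => w' _; rewrite (pE _ w0) -/p; ring.
by rewrite attach_pmf_sum1 mul1r (pE _ w0).
Qed.

End expectation.

Section sum_sqr.
Context {R : realType}.

(** Cauchy-Schwarz against the constant 1, obtained by summing [a b <= a^2 / 2 + b^2 / 2] over all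
    pairs. *)
Lemma sqr_sum_le (I : finType) (A : {set I}) (a : I -> R) :
  (\sum_(i in A) a i) ^+ 2 <= #|A|%:R * \sum_(i in A) a i ^+ 2.
Proof.
rewrite expr2 big_distrlr/=.
have le2 i j : a i * a j <= 2^-1 * a i ^+ 2 + 2^-1 * a j ^+ 2.
  by have := sqr_ge0 (a i - a j); rewrite sqrrB -mulr_natr; lra.
apply: (@le_trans _ _ (\sum_(i in A) \sum_(j in A) (2^-1 * a i ^+ 2 + 2^-1 * a j ^+ 2))).
  by apply: ler_sum => i _; apply: ler_sum => j _; exact: le2.
rewrite (eq_bigr (fun i => (2^-1 * a i ^+ 2) *+ #|A| + \sum_(j in A) 2^-1 * a j ^+ 2)); last first.
  by move=> i _; rewrite big_split/= sumr_const.
rewrite big_split/= sumr_const sumrMnl -!mulr_sumr.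
rewrite -mulrnDl -mulrDl (_ : 2^-1 + 2^-1 = 1 :> R) ?mul1r ?mulr_natl//.
by lra.
Qed.

End sum_sqr.

(** * Stein's method for local dependence *)

Section local_dependence.
Context {R : realType} {m n : nat}.
Variables (I : finType) (F : I -> {set edge m n}) (X : I -> outcome m n -> R).
Hypothesis X0 : forall i w, 0 <= X i w.
Hypothesis XF : forall i, determined (F i) (X i).
Variable k : nat.
Hypothesis Fk : forall i, (#|F i| <= k)%N.

Let xi i w := X i w - Ex (X i).
(** An index is its own neighbour except when [F i] is empty; then [X i] is constant and [xi i]
    vanishes, so nothing is lost. *)
Let nb i j := ~~ [disjoint F i & F j].
Let eta i w := \sum_(j | nb i j) xi j w.
Let S w := \sum_i xi i w.

Let xiF i : determined (F i) (xi i).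
Proof. exact: (determined_comp (fun x => x - _) (@XF i)). Qed.

Let Ex_xi i : Ex (xi i) = 0.
Proof. by rewrite ExB Ex_cst subrr. Qed.

Definition edge_load (e : edge m n) w : R := \sum_(i | e \in F i) X i w.

(* [Z i] dominates [`|xi i|], and the neighbourhood sums of the [xi j] are
   dominated by [A i]; since [Ex (A i) <= 2 * A i] pointwise, the products of
   expectations that occur below need no decoupling. *)
Let Z i w := X i w + Ex (X i).
Let M e w := \sum_(i | e \in F i) Z i w.
Let A i w := \sum_(e in F i) M e w.
Let Q := \sum_i Ex (fun w => Z i w * A i w ^+ 2).

Let Z0 i w : 0 <= Z i w.
Proof. by rewrite addr_ge0// Ex_ge0. Qed.

Let M0 e w : 0 <= M e w.
Proof. by apply: sumr_ge0. Qed.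

Let A0 i w : 0 <= A i w.
Proof. by apply: sumr_ge0. Qed.

Let ME e w : M e w = edge_load e w + Ex (edge_load e).
Proof. by rewrite /M big_split/= -Ex_sum. Qed.

Let load0 e w : 0 <= edge_load e w.
Proof. by apply: sumr_ge0. Qed.

Let xiZ i w : `|xi i w| <= Z i w.
Proof.
by rewrite (le_trans (ler_normB _ _))// !ger0_norm// Ex_ge0.
Qed.

Let nbC i j : nb i j = nb j i.
Proof. by rewrite /nb disjoint_sym. Qed.

(** A union bound: a neighbour [j] of [i] shares some edge with it and so appears at least once on
    the right. It turns dependency neighbourhoods into loads of edges. *)
Let nb_sum_le i (a : I -> R) : (forall j, 0 <= a j) ->
  \sum_(j | nb i j) a j <= \sum_(e in F i) \sum_(j | e \in F j) a j.
Proof.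
move=> a0; rewrite (exchange_big_dep xpredT)//= big_mkcond/=.
apply: ler_sum => j _; case: ifPn => [|_]; last exact: sumr_ge0.
rewrite /nb -setI_eq0 => /set0Pn[e]; rewrite inE => /andP[ei ej].
rewrite (bigD1 e) ?ei ?ej//= lerDl; exact: sumr_ge0.
Qed.

Let etaA i w : `|eta i w| <= A i w.
Proof.
rewrite (le_trans (ler_norm_sum _ _ _))//.
apply: (le_trans (ler_sum _ (fun j _ => xiZ j w))).
exact: (nb_sum_le _ (Z0^~ w)).
Qed.

Let ExM_le e w : Ex (M e) <= 2 * M e w.
Proof.
rewrite (eq_Ex (ME e)) ExD Ex_cst ME; have := load0 e w.
by have := Ex_ge0 (load0 e); lra.
Qed.

Let ExA_le i w : Ex (A i) <= 2 * A i w.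
Proof. by rewrite Ex_sum mulr_sumr; apply: ler_sum => e _; exact: ExM_le. Qed.

Let ZZA_le : \sum_i \sum_(j | nb i j) Ex (fun w => Z i w * Z j w * A i w) <= Q.
Proof.
apply: ler_sum => i _; rewrite -Ex_sum; apply: le_Ex => w.
rewrite -mulr_suml -mulr_sumr expr2 mulrA ler_wpM2r// ler_wpM2l//.
exact: (nb_sum_le _ (Z0^~ w)).
Qed.

Let ZZA'_le : \sum_i \sum_(j | nb i j) Ex (fun w => Z i w * Z j w * A j w) <= Q.
Proof.
rewrite (exchange_big_dep xpredT)//=; apply: le_trans ZZA_le.
rewrite le_eqVlt; apply/orP; left; apply/eqP; apply: eq_bigr => i _.
apply: eq_big => [j|j _]; first exact: nbC.
by apply: eq_Ex => w; rewrite [Z j w * _]mulrC.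
Qed.

Let ExM3_le e : Ex (fun w => M e w ^+ 3) <= 8 * Ex (fun w => edge_load e w ^+ 3).
Proof.
set a := Ex (edge_load e).
have a0 : 0 <= a by exact: Ex_ge0.
(* Jensen, from the tangent line of the cube at the mean. *)
have a3 : a ^+ 3 <= Ex (fun w => edge_load e w ^+ 3).
  have -> : a ^+ 3 = Ex (fun w => a ^+ 3 + 3 * a ^+ 2 * (edge_load e w - a)).
    by rewrite ExD ExZ ExB !Ex_cst subrr mulr0 addr0.
  apply: le_Ex => w; rewrite -subr_ge0; set u := edge_load e w.
  have -> : u ^+ 3 - (a ^+ 3 + 3 * a ^+ 2 * (u - a)) = (u - a) ^+ 2 * (u + 2 * a) by ring.
  by rewrite mulr_ge0 ?sqr_ge0// addr_ge0 ?mulr_ge0 ?load0.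
apply: (@le_trans _ _ (Ex (fun w => 4 * edge_load e w ^+ 3 + 4 * a ^+ 3))).
  apply: le_Ex => w; rewrite ME -/a -subr_ge0; set u := edge_load e w.
  have -> : 4 * u ^+ 3 + 4 * a ^+ 3 - (u + a) ^+ 3 = 3 * ((u - a) ^+ 2 * (u + a)) by ring.
  by rewrite mulr_ge0// mulr_ge0 ?sqr_ge0// addr_ge0 ?load0.
by rewrite ExD Ex_cst ExZ; lra.
Qed.

(** Cauchy-Schwarz over the at most [k] edges of [F i] replaces [A i ^+ 2] by the sum of the
    [M e ^+ 2]. After exchanging the sums, the [Z i] with [e] in [F i] add up to one more factor
    [M e]. *)
Let Q_le : Q <= k%:R * (8 * \sum_e Ex (fun w => edge_load e w ^+ 3)).
Proof.
apply: (@le_trans _ _ (k%:R * \sum_e Ex (fun w => M e w ^+ 3))); last first.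
  by rewrite ler_wpM2l// mulr_sumr; apply: ler_sum => e _; exact: ExM3_le.
rewrite /Q -!Ex_sum -ExZ; apply: le_Ex => w.
apply: (@le_trans _ _ (\sum_i k%:R * \sum_(e in F i) Z i w * M e w ^+ 2)).
  apply: ler_sum => i _; rewrite -mulr_sumr [leRHS]mulrCA; apply: ler_wpM2l => //.
  rewrite (le_trans (sqr_sum_le _ _))// ler_wpM2r ?ler_nat//.
  by apply: sumr_ge0 => e _; exact: sqr_ge0.
rewrite -mulr_sumr ler_wpM2l// (exchange_big_dep xpredT)//= le_eqVlt.
by apply/orP; left; apply/eqP; apply: eq_bigr => e _; rewrite -mulr_suml [RHS]exprS.
Qed.

(** [S - eta i] only involves indices whose edge sets avoid [F i], so it is independent of the
    centred variable [xi i]. *)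
Let Ex_xi_off i (f : R -> R) : Ex (fun w => xi i w * f (S w - eta i w)) = 0.
Proof.
rewrite (@Ex_indep _ _ _ (F i)) ?Ex_xi ?mul0r//.
apply: determined_comp.
have E w : S w - eta i w = \sum_(j | ~~ nb i j) xi j w.
  by rewrite /S (bigID (nb i))/= -/(eta i w) addrAC subrr add0r.
move=> w w' ww'; rewrite !E; apply: (@determined_sum _ _ _ (~: F i)) ww' => j.
rewrite negbK => dij; apply: (determinedS _ (@xiF j)).
by rewrite -finset.disjoints_subset disjoint_sym.
Qed.

Let variance_eta : Ex (fun w => S w ^+ 2) = \sum_i Ex (fun w => xi i w * eta i w).
Proof.
rewrite -[LHS]subr0 -[X in _ - X](big1_eq (idx := 0) (op := +%R) (index_enum I) xpredT).
have -> : \sum_(i : I) 0 = \sum_i Ex (fun w => xi i w * id (S w - eta i w)).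
  by apply: eq_bigr => i _; rewrite (Ex_xi_off i id).
rewrite -!Ex_sum -ExB; apply: eq_Ex => w; rewrite expr2 [X in X * _]/S mulr_suml -sumrB.
by apply: eq_bigr => i _ /=; ring.
Qed.

Let SE w : S w = \sum_i X i w - Ex (fun w => \sum_i X i w).
Proof. by rewrite /S Ex_sum -sumrB. Qed.

(** Only pairs sharing an edge contribute, and by nonnegativity their covariance is at most
    [Ex (X i * X j)]. Exchanging the sums then produces the squared loads. *)
Lemma local_variance_le :
  Ex (fun w => (\sum_i X i w - Ex (fun w => \sum_i X i w)) ^+ 2) <=
  \sum_e Ex (fun w => edge_load e w ^+ 2).
Proof.
rewrite (@eq_Ex _ _ _ _ (fun w => S w ^+ 2)); last by move=> w; rewrite SE.
rewrite variance_eta.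
apply: (@le_trans _ _ (\sum_i \sum_(j | nb i j) Ex (fun w => X i w * X j w))).
  apply: ler_sum => i _; rewrite (_ : Ex _ = \sum_(j | nb i j) Ex (fun w => xi i w * xi j w)).
    apply: ler_sum => j _.
    rewrite (@eq_Ex _ _ _ _ (fun w => X i w * X j w -
      (Ex (X j) * X i w + Ex (X i) * X j w - Ex (X i) * Ex (X j)))); last first.
      by move=> w; rewrite /xi; ring.
    rewrite ExB ExB ExD !ExZ Ex_cst gerBl.
    by have := mulr_ge0 (Ex_ge0 (X0 i)) (Ex_ge0 (X0 j)); lra.
  by rewrite -Ex_sum; apply: eq_Ex => w; rewrite mulr_sumr.
rewrite -Ex_sum.
under eq_bigr do rewrite -Ex_sum.
rewrite -Ex_sum; apply: le_Ex => w.
apply: (@le_trans _ _ (\sum_i X i w * \sum_(e in F i) edge_load e w)).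
  apply: ler_sum => i _; rewrite -mulr_sumr; apply: ler_wpM2l => //.
  exact: (nb_sum_le _ (X0^~ w)).
under eq_bigr do rewrite mulr_sumr.
rewrite (exchange_big_dep xpredT)//= le_eqVlt.
by apply/orP; left; apply/eqP; apply: eq_bigr => e _; rewrite -mulr_suml expr2.
Qed.

(** Removing the neighbourhoods of both [i] and [j] makes [S - zeta i j] independent of the product
    [xi i * xi j]. *)
Let zeta i j w := \sum_(l | nb i l || nb j l) xi l w.

Let zetaA i j w : `|zeta i j w| <= A i w + A j w.
Proof.
rewrite (le_trans (ler_norm_sum _ _ _))//.
apply: (@le_trans _ _ (\sum_(l | nb i l) Z l w + \sum_(l | nb j l) Z l w)).
  rewrite big_mkcond [in leRHS]big_mkcond [X in _ <= _ + X]big_mkcond -big_split/=.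
  apply: ler_sum => l _; have := xiZ l w; have := Z0 l w.
  by case: (nb i l); case: (nb j l) => /= *; lra.
by apply: lerD; exact: (nb_sum_le _ (Z0^~ w)).
Qed.

Let Ex_xixi_off i j (h : R -> R) :
  Ex (fun w => xi i w * xi j w * h (S w - zeta i j w)) =
  Ex (fun w => xi i w * xi j w) * Ex (fun w => h (S w - zeta i j w)).
Proof.
apply: (@Ex_indep _ _ _ (F i :|: F j)).
  by apply: determined_mul; apply: (determinedS _ (@xiF _)); rewrite ?finset.subsetUl ?finset.subsetUr.
apply: determined_comp.
have E w : S w - zeta i j w = \sum_(l | ~~ (nb i l || nb j l)) xi l w.
  by rewrite /S (bigID (fun l => nb i l || nb j l))/= -/(zeta i j w) addrAC subrr add0r.
move=> w w' ww'; rewrite !E; apply: (@determined_sum _ _ _ (~: (F i :|: F j))) ww' => l.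
rewrite negb_or !negbK => /andP[dil djl]; apply: (determinedS _ (@xiF l)).
by rewrite finset.setCU finset.subsetI -!finset.disjoints_subset !(disjoint_sym (F l)) dil.
Qed.

(** [s ^+ 2] times the left side splits into two errors. Expanding [f] between [S / s] and
    [(S - eta i) / s] costs [K / s * Q]. Replacing the products [xi i * xi j] by their means, whose
    sum is [s ^+ 2], costs [3 * K / s * (Q + Q)]. The total is [7 * K / s * Q], and the 8 of [Q_le]
    makes it 56. *)
Lemma local_dependence_stein (s K : R) (f g : R -> R) : 0 < s -> 0 <= K ->
  s ^+ 2 = Ex (fun w => (\sum_i X i w - Ex (fun w => \sum_i X i w)) ^+ 2) ->
  (forall x y, `|g x - g y| <= K * `|x - y|) ->
  (forall x y, `|f y - f x - g x * (y - x)| <= K * `|y - x| ^+ 2) ->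
  let y w := (\sum_i X i w - Ex (fun w => \sum_i X i w)) / s in
  `|Ex (fun w => g (y w) - y w * f (y w))| <=
    56 * K * k%:R * (\sum_e Ex (fun w => edge_load e w ^+ 3)) / s ^+ 3.
Proof.
move=> s0 K0 s2 gL fT; set y := fun w => S w / s => /=.
rewrite [X in `|X|](@eq_Ex _ _ _ _ (fun w => g (y w) - y w * f (y w))); last first.
  by move=> w; rewrite /y SE.
have {}s2 : s ^+ 2 = \sum_i \sum_(j | nb i j) Ex (fun w => xi i w * xi j w).
  rewrite s2 [LHS](@eq_Ex _ _ _ _ (fun w => S w ^+ 2)); last by move=> w; rewrite SE.
  rewrite variance_eta; apply: eq_bigr => i _.
  by rewrite -Ex_sum; apply: eq_Ex => w; rewrite mulr_sumr.
pose D i w := f (y w) - f ((S w - eta i w) / s).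
have Eyf : s * Ex (fun w => y w * f (y w)) = \sum_i Ex (fun w => xi i w * D i w).
  rewrite -ExZ (@eq_Ex _ _ _ _ (fun w => \sum_i xi i w * f (y w))); last first.
    move=> w; rewrite -mulr_suml -/(S w) mulrA; congr (_ * _).
    by rewrite /y; field; rewrite gt_eqF.
  rewrite Ex_sum; apply: eq_bigr => i _; rewrite -[LHS]subr0.
  rewrite -[X in _ - X](Ex_xi_off i (fun x => f (x / s))) -ExB.
  by apply: eq_Ex => w; rewrite -mulrBr.
have D_le i : `|s * Ex (fun w => xi i w * D i w) - Ex (fun w => g (y w) * (xi i w * eta i w))| <=
    K / s * Ex (fun w => Z i w * A i w ^+ 2).
  rewrite -!ExZ -ExB (le_trans (ler_norm_Ex _))//; apply: le_Ex => w.
  have -> : s * (xi i w * D i w) - g (y w) * (xi i w * eta i w) =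
      - (s * xi i w) * (f ((S w - eta i w) / s) - f (y w) - g (y w) * ((S w - eta i w) / s - y w)).
    by rewrite /D /y; field; rewrite gt_eqF.
  rewrite normrM normrN normrM (gtr0_norm s0).
  have -> : K / s * (Z i w * A i w ^+ 2) = (s * Z i w) * (K * (A i w / s) ^+ 2).
    by field; rewrite gt_eqF.
  apply: ler_pM => //; [by rewrite mulr_ge0// ltW|by rewrite ler_pM2l|].
  rewrite (le_trans (fT _ _))// ler_wpM2l//.
  have -> : (S w - eta i w) / s - y w = - (eta i w / s) by rewrite /y; field; rewrite gt_eqF.
  rewrite normrN normrM [`|s^-1|]gtr0_norm ?invr_gt0// lerXn2r ?nnegrE//.
  - by rewrite mulr_ge0// invr_ge0 ltW.
  - by rewrite mulr_ge0// invr_ge0 ltW.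
  - by rewrite ler_pM2r ?invr_gt0.
have gy_le i j w : `|g (y w) - g ((S w - zeta i j w) / s)| <= K / s * (A i w + A j w).
  rewrite (le_trans (gL _ _))// -mulrA ler_wpM2l//.
  have -> : y w - (S w - zeta i j w) / s = s^-1 * zeta i j w by rewrite /y; field; rewrite gt_eqF.
  by rewrite normrM gtr0_norm ?invr_gt0// ler_pM2l ?invr_gt0.
(* Both [g (y w)] factors are compared with the value at [(S - zeta i j) / s], where the expectation
   factorises. The error is counted once for the product and twice for the product of expectations,
   because [ExA_le] costs a factor 2. *)
have g_le i j : `|Ex (fun w => xi i w * xi j w) * Ex (fun w => g (y w)) -
      Ex (fun w => g (y w) * (xi i w * xi j w))| <=
    3 * K / s * Ex (fun w => Z i w * Z j w * (A i w + A j w)).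
  have Ks0 : 0 <= K / s by rewrite divr_ge0// ltW.
  have xx_le w : `|xi i w * xi j w| <= Z i w * Z j w by rewrite normrM ler_pM.
  have -> : Ex (fun w => xi i w * xi j w) * Ex (fun w => g (y w)) -
      Ex (fun w => g (y w) * (xi i w * xi j w)) =
    Ex (fun w => xi i w * xi j w) * Ex (fun w => g (y w) - g ((S w - zeta i j w) / s)) -
    Ex (fun w => xi i w * xi j w * (g (y w) - g ((S w - zeta i j w) / s))).
    rewrite [X in _ = _ - X](@eq_Ex _ _ _ _ (fun w => g (y w) * (xi i w * xi j w) -
       xi i w * xi j w * g ((S w - zeta i j w) / s))); last by move=> w; ring.
    by rewrite !ExB (Ex_xixi_off i j (fun x => g (x / s))); ring.
  rewrite (le_trans (ler_normB _ _))//.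
  have E1 : `|Ex (fun w => xi i w * xi j w * (g (y w) - g ((S w - zeta i j w) / s)))| <=
      K / s * Ex (fun w => Z i w * Z j w * (A i w + A j w)).
    rewrite -ExZ (le_trans (ler_norm_Ex _))//; apply: le_Ex => w.
    by rewrite normrM [leRHS]mulrCA ler_pM.
  have E2 : `|Ex (fun w => xi i w * xi j w) * Ex (fun w => g (y w) - g ((S w - zeta i j w) / s))| <=
      2 * (K / s * Ex (fun w => Z i w * Z j w * (A i w + A j w))).
    rewrite normrM.
    apply: (@le_trans _ _ (Ex (fun w => Z i w * Z j w) * (K / s * Ex (fun w => A i w + A j w)))).
      apply: ler_pM => //.
        by rewrite (le_trans (ler_norm_Ex _))//; exact: le_Ex.
      by rewrite -ExZ (le_trans (ler_norm_Ex _))//; apply: le_Ex => w; exact: gy_le.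
    rewrite mulrCA [leRHS]mulrCA ler_wpM2l// mulrC -!ExZ; apply: le_Ex => w.
    rewrite mulrC mulrCA ler_wpM2l ?mulr_ge0// ExD mulrDr.
    by apply: lerD; exact: ExA_le.
  have -> : 3 * K / s = 3 * (K / s) by rewrite mulrA.
  by rewrite -mulrA; move: E1 E2; set u := K / s * _; lra.
have key : s ^+ 2 * `|Ex (fun w => g (y w) - y w * f (y w))| <= 7 * K / s * Q.
  rewrite -[X in X * _]ger0_norm ?sqr_ge0// -normrM ExB mulrBr.
  have -> : s ^+ 2 * Ex (fun w => g (y w)) - s ^+ 2 * Ex (fun w => y w * f (y w)) =
      \sum_i \sum_(j | nb i j) (Ex (fun w => xi i w * xi j w) * Ex (fun w => g (y w)) -
        Ex (fun w => g (y w) * (xi i w * xi j w))) -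
      \sum_i (s * Ex (fun w => xi i w * D i w) - Ex (fun w => g (y w) * (xi i w * eta i w))).
    set B := \sum_i Ex (fun w => g (y w) * (xi i w * eta i w)).
    rewrite [X in _ = _ - X]sumrB -[X in _ = _ - (X - _)]mulr_sumr -Eyf -/B mulrA -expr2.
    rewrite (eq_bigr (fun i => (\sum_(j | nb i j) Ex (fun w => xi i w * xi j w)) *
      Ex (fun w => g (y w)) - Ex (fun w => g (y w) * (xi i w * eta i w)))); last first.
      move=> i _; rewrite sumrB -mulr_suml; congr (_ - _).
      by rewrite -Ex_sum; apply: eq_Ex => w; rewrite -!mulr_sumr.
    by rewrite sumrB -mulr_suml -s2 -/B; ring.
  rewrite (le_trans (ler_normB _ _))//.
  have -> : 7 * K / s * Q = 3 * K / s * (Q + Q) + K / s * Q by ring.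
  apply: lerD; last first.
    rewrite (le_trans (ler_norm_sum _ _ _))// mulr_sumr; apply: ler_sum => i _; exact: D_le.
  apply: (@le_trans _ _ (3 * K / s *
    \sum_i \sum_(j | nb i j) Ex (fun w => Z i w * Z j w * (A i w + A j w)))).
    rewrite (le_trans (ler_norm_sum _ _ _))// mulr_sumr; apply: ler_sum => i _.
    rewrite (le_trans (ler_norm_sum _ _ _))// mulr_sumr; apply: ler_sum => j _; exact: g_le.
  apply: ler_wpM2l; first by rewrite divr_ge0 ?mulr_ge0// ltW.
  apply: le_trans (lerD ZZA_le ZZA'_le); rewrite -big_split; apply: ler_sum => i _ /=.
  rewrite -big_split/=; apply: ler_sum => j _; rewrite -ExD.
  by apply: le_Ex => w; rewrite mulrDr.
rewrite ler_pdivlMr ?exprn_gt0//.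
have -> : `|Ex (fun w => g (y w) - y w * f (y w))| * s ^+ 3 =
  s * (s ^+ 2 * `|Ex (fun w => g (y w) - y w * f (y w))|) by ring.
apply: (@le_trans _ _ (s * (7 * K / s * Q))); first by rewrite ler_pM2l.
have -> : s * (7 * K / s * Q) = 7 * K * Q by field; rewrite gt_eqF.
rewrite (le_trans (ler_wpM2l _ Q_le)) ?mulr_ge0//.
by rewrite le_eqVlt; apply/orP; left; apply/eqP; ring.
Qed.

End local_dependence.

(** * From integrals on the outcome space to finite sums *)

Section transfer.
Context {R : realType} {m n : nat}.
Implicit Types (g : outcome m n -> R) (w : outcome m n).
Local Notation P := (attach_prob R m n).

Lemma integral_attach_prob g : (\int[P]_w (g w)%:E = (Ex g)%:E)%E.
Proof.
have mF (f : outcome m n -> \bar R) : measurable_fun [set: outcome m n] f by [].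
have Pv v : P [set v] = (attach_pmf R v)%:E by rewrite /attach_prob fsbig_set1.
pose c v w : R := g v * \1_[set v] w.
have -> : (fun w => (g w)%:E) = (fun w => \sum_(v : outcome m n) (c v w)%:E)%E.
  apply/funext => w; rewrite sumEFin; congr (_%:E).
  rewrite (bigD1 w)//= /c indicE mem_set//= mulr1 big1 ?addr0// => v vw.
  by rewrite indicE memNset ?mulr0//= => /esym/eqP; rewrite (negbTE vw).
have ind v : P.-integrable [set: outcome m n] (fun w => (\1_[set v] w)%:E).
  exact: integrable_indic.
rewrite integral_sum//=; last first.
  move=> v; rewrite /c; under [X in _.-integrable _ X]funext do rewrite EFinM.
  exact: integrableZl.
rewrite /Ex -sumEFin; apply: eq_bigr => v _.
under eq_integral do rewrite EFinM.
by rewrite integralZl// integral_indic// setIT [X in (_ * X)%E](Pv v) -EFinM mulrC.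
Qed.

Lemma expectation_attach_prob g : ('E_P[g] = (Ex g)%:E)%E.
Proof. by rewrite unlock integral_attach_prob. Qed.

Lemma variance_attach_prob g : ('V_P[g] = (Ex (fun w => (g w - Ex g)%R ^+ 2)%R)%:E)%E.
Proof.
rewrite /variance unlock expectation_attach_prob/= expectation_attach_prob.
by congr (_%:E); apply: eq_Ex.
Qed.

Lemma integrable_attach_prob g : P.-integrable [set: outcome m n] (EFin \o g).
Proof.
apply/integrableP; split => //.
by rewrite (integral_attach_prob (fun w => `|g w|)) ltry.
Qed.

End transfer.

Section copies_law.
Context {R : realType} {m n : nat} (V : finType) (L : rel V).

Lemma copies_meanE : copies_mean R m n L = Ex (@copies R m n V L).
Proof. by rewrite /copies_mean expectation_attach_prob. Qed.

Lemma copies_varE : copies_var R m n L =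
  Ex (fun w : outcome m n => (@copies R m n V L w - Ex (@copies R m n V L)) ^+ 2).
Proof. by rewrite /copies_var variance_attach_prob. Qed.

Lemma integral_copies_std_law (h : R -> R) : measurable_fun [set: measurableTypeR R] h ->
  (\int[copies_std_law R m n L]_x (h x)%:E = (Ex (fun w => h (@copies_std R m n V L w)))%:E)%E.
Proof.
move=> mh; rewrite -integral_attach_prob integral_distribution//.
  exact/measurable_EFinP.
exact: integrable_attach_prob.
Qed.

End copies_law.

(** * Walks and copies through an edge *)

Section power_sums.
Implicit Types (p q k n : nat).

Lemma expn_sum_le (I : finType) (P : pred I) (x : I -> nat) p :
  ((\sum_(i | P i) x i) ^ p.+1 <= #|P| ^ p.+1 * \sum_(i | P i) x i ^ p.+1)%N.
Proof.
have [P0|P0] := posnP #|P|.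
  rewrite big_pred0 ?exp0n// => i.
  by have /card0_eq/(_ i) := P0; rewrite unfold_in.
have [i Pi Ei] := eq_bigmax_cond x P0.
apply: (@leq_trans ((#|P| * x i) ^ p.+1)).
  rewrite leq_exp2r// -sum_nat_const; apply: leq_sum => j Pj.
  by rewrite -Ei; exact: leq_bigmax_cond.
rewrite expnMn leq_mul2l; apply/orP; right.
by rewrite (bigD1 i)//= leq_addr.
Qed.

Lemma expnD_le x y p : ((x + y) ^ p <= 2 ^ p * (x ^ p + y ^ p))%N.
Proof.
apply: (@leq_trans ((2 * maxn x y) ^ p)).
  by case: p => // p; rewrite leq_exp2r// mul2n -addnn leq_add ?leq_maxl ?leq_maxr.
rewrite expnMn leq_mul2l; apply/orP; right.
by rewrite /maxn; case: ifP => _; rewrite ?leq_addl ?leq_addr.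
Qed.

Lemma muln_le_sqr x y : (x * y <= x ^ 2 + y ^ 2)%N.
Proof.
by have [xy|yx] := leqP x y; [apply: leq_trans (leq_addl _ _)|apply: leq_trans (leq_addr _ _)];
  rewrite -mulnn leq_mul// ltnW.
Qed.

Lemma bin_le_expn n k : ('C(n, k) <= n.+1 ^ k)%N.
Proof.
elim: n k => [|n IH] [|k]; rewrite ?bin0 ?bin0n//.
rewrite binS (leq_trans (leq_add (IH k.+1) (IH k)))// [(n.+1 ^ k.+1)%N]expnS -mulSnr.
by rewrite expnS; apply: leq_mul => //; case: k => // k; rewrite leq_exp2r.
Qed.

End power_sums.

(** * Walk counts in a multigraph and their moments *)

Section walks.
Variables (T H : finType) (s t : H -> T).

Definition deg v := (#|[pred h | s h == v]| + #|[pred h | t h == v]|)%N.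

(** The adjacency operator of the multigraph with edge set [H] and end maps [s] and [t]. *)
Definition nbsum (f : T -> nat) v :=
  (\sum_(h | s h == v) f (t h) + \sum_(h | t h == v) f (s h))%N.

(** Self-adjointness of the adjacency operator, tested against the constant function 1, whose image
    is [deg]. *)
Lemma sum_nbsum f : (\sum_v nbsum f v = \sum_v deg v * f v)%N.
Proof.
have E (a b : H -> T) : (\sum_v \sum_(h | a h == v) f (b h) = \sum_v #|[pred h | b h == v]| * f v)%N.
  rewrite (exchange_big_dep xpredT)//=.
  rewrite (eq_bigr (fun h => f (b h))); last first.
    by move=> h _; rewrite (big_pred1 (a h))// => v; rewrite eq_sym.
  rewrite (partition_big b xpredT)//=; apply: eq_bigr => v _.
  by rewrite -sum_nat_const; apply: eq_bigr => h /eqP ->.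
rewrite big_split/= E E -big_split/=.
by apply: eq_bigr => v _; rewrite addnC -mulnDl.
Qed.

Lemma nbsum_exp_le f p v :
  (nbsum f v ^ p.+1 <= 2 ^ p.+1 * (deg v ^ p.+1 * nbsum (fun u => f u ^ p.+1) v))%N.
Proof.
apply: (leq_trans (expnD_le _ _ _)); apply: leq_mul => //; rewrite mulnDr.
by apply: leq_add; apply: (leq_trans (expn_sum_le _ _ _)); apply: leq_mul => //;
  rewrite leq_exp2r// ?leq_addr ?leq_addl.
Qed.

(* [ball r v] bounds the number of edges seen from [v] by walks of length at
   most [r]. *)
Fixpoint ball r v : nat :=
  if r is r'.+1 then ((deg v).+1 + nbsum (ball r') v)%N else (deg v).+1.

Definition deg_moment q := (\sum_v (deg v).+1 ^ q)%N.

Lemma deg_moment_mono q q' : (q <= q')%N -> (deg_moment q <= deg_moment q')%N.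
Proof. by move=> qq'; apply: leq_sum => v _; rewrite leq_pexp2l. Qed.

End walks.

(** The factor and the degree exponent in [ball_moment]. One step of radius uses [x y <= x^2 + y^2]
    twice to separate degrees from balls, which quadruples the order of the moment; orders are
    written [p.+1] to stay positive. *)
Fixpoint ball_const r p : nat * nat :=
  if r is r'.+1 then
    let: (K, q) := ball_const r' (4 * p.+1).-1 in
    (2 ^ p.+1 * (1 + 2 ^ p.+1 * (2 + K)), (q + (2 * p.+1).+2))%N
  else (1, p.+1)%N.

Lemma ball_moment (r p : nat) (T H : finType) (s t : H -> T) :
  (\sum_v ball s t r v ^ p.+1 <=
   (ball_const r p).1 * deg_moment s t (ball_const r p).2)%N.
Proof.
elim: r p => [|r IH] p; first by rewrite /= mul1n.
have := IH (4 * p.+1).-1; rewrite /=.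
case: (ball_const r (4 * p.+1).-1) => K q/=.
have -> : (4 * p.+1).-1.+1 = (4 * p.+1)%N by rewrite prednK.
move=> {}IH.
(* A single degree moment that dominates all those met below, of orders [p.+1], [(2 * p.+1).+1], 2
   and [q]. *)
set D := deg_moment s t (q + (2 * p.+1).+2)%N.
have DM q' : (q' <= (2 * p.+1).+2)%N -> (deg_moment s t q' <= D)%N.
  by move=> qq'; apply: deg_moment_mono; rewrite (leq_trans qq')// leq_addl.
apply: (@leq_trans (\sum_v 2 ^ p.+1 * ((deg s t v).+1 ^ p.+1 + nbsum s t (ball s t r) v ^ p.+1))%N).
  by apply: leq_sum => v _; exact: expnD_le.
rewrite -big_distrr/= -mulnA; apply: leq_mul => //.
rewrite big_split mulnDl mul1n; apply: leq_add.
  by apply: (DM p.+1); lia.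
apply: (@leq_trans (\sum_v 2 ^ p.+1 * (deg s t v ^ (2 * p.+1).+1 +
    nbsum s t (fun u => ball s t r u ^ (2 * p.+1)) v))%N).
  apply: leq_sum => v _; apply: (leq_trans (nbsum_exp_le _ _ _ _ _)); apply: leq_mul => //.
  rewrite /nbsum mulnDr !big_distrr/=.
  have E (P : pred H) (a : H -> T) : (\sum_(h | P h) deg s t v ^ p.+1 * ball s t r (a h) ^ p.+1 <=
      #|P| * deg s t v ^ (2 * p.+1) + \sum_(h | P h) ball s t r (a h) ^ (2 * p.+1))%N.
    rewrite -sum_nat_const -big_split/=; apply: leq_sum => h _.
    by rewrite (leq_trans (muln_le_sqr _ _))// -!expnM ![(p.+1 * 2)%N]mulnC.
  apply: (leq_trans (leq_add (E _ _) (E _ _))).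
  by rewrite addnACA -mulnDl expnS.
rewrite -big_distrr/= -mulnA; apply: leq_mul => //.
rewrite big_split/= (_ : 2 + K = 1 + (1 + K))%N// [((1 + (1 + K)) * D)%N]mulnDl mul1n.
apply: leq_add.
  apply: leq_trans (DM (2 * p.+1).+1 _) => //.
  by apply: leq_sum => v _; rewrite leq_exp2r.
rewrite sum_nbsum.
apply: (@leq_trans (\sum_v (deg s t v ^ 2 + ball s t r v ^ (4 * p.+1)))%N).
  apply: leq_sum => v _; apply: (leq_trans (muln_le_sqr _ _)).
  by rewrite -expnM mulnAC.
rewrite big_split mulnDl mul1n; apply: leq_add.
  apply: leq_trans (DM 2 _) => //.
  by apply: leq_sum => v _; rewrite leq_exp2r.
apply: (leq_trans IH); apply: leq_mul => //.
by apply: deg_moment_mono; rewrite leq_addr.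
Qed.

(** * Counting the copies through a given edge *)

Section copies_through_edge.
Local Open Scope set_scope.
Variables (m n : nat) (w : outcome m n) (V : finType) (L : rel V).
Local Notation src := (@edge_source m n).
Local Notation tgt := (@edge_target m n w).
Hypothesis Lc : forall x y, connect L x y.

Definition is_copy (a : {set 'I_n} * {set edge m n}) :=
  is_subgraph w a.1 a.2 && subgraph_isom w L a.1 a.2.

Definition incident v : {set edge m n} :=
  [set e | (src e == v) || (tgt e == v)].

Fixpoint edge_ball r v : {set edge m n} :=
  if r is r'.+1 then
    incident v :|: (\bigcup_(e | src e == v) edge_ball r' (tgt e)) :|:
      (\bigcup_(e | tgt e == v) edge_ball r' (src e))
  else incident v.

Lemma edge_ball0_subset r v : incident v \subset edge_ball r v.
Proof. by case: r => // r; rewrite /= -finset.setUA finset.subsetUl. Qed.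

Lemma leq_card_bigcup (I T : finType) (P : pred I) (A : I -> {set T}) :
  (#|\bigcup_(i | P i) A i| <= \sum_(i | P i) #|A i|)%N.
Proof.
elim/big_rec2: _ => [|i N B _ IH]; first by rewrite cards0.
by rewrite (leq_trans (leq_card_setU _ _))// leq_add2l.
Qed.

(** The strict inequality comes from the successor in [ball] and pays for the [n.+1] of
    [bin_le_expn]. *)
Lemma card_edge_ball r v : (#|edge_ball r v| < ball src tgt r v)%N.
Proof.
have c0 u : (#|incident u| <= deg src tgt u)%N.
  have -> : incident u = [set e in [pred e | src e == u]] :|: [set e in [pred e | tgt e == u]].
    by apply/setP => e; rewrite !inE.
  by rewrite (leq_trans (leq_card_setU _ _))// !cardsE.
elim: r v => [|r IH] v; first by rewrite ltnS c0.
rewrite [ball _ _ _ _]/= addSn ltnS /= -finset.setUA.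
rewrite (leq_trans (leq_card_setU _ _))// leq_add ?c0//.
rewrite (leq_trans (leq_card_setU _ _))// /nbsum leq_add//;
  by rewrite (leq_trans (leq_card_bigcup _ _))//; apply: leq_sum => e _; exact: ltnW.
Qed.

Lemma edge_neq (e : edge m n) : src e != tgt e.
Proof. by apply/eqP => /(congr1 val)/= E; have := ltn_ord (w e); rewrite -{1}E ltnn. Qed.

Lemma edge_ball_mono r v : edge_ball r v \subset edge_ball r.+1 v.
Proof.
elim: r v => [|r IH] v; first exact: (edge_ball0_subset 1).
rewrite [edge_ball r.+2 v]/= [edge_ball r.+1 v]/=.
apply: finset.setUSS; first apply: finset.setUS.
  by apply/bigcupsP => e ev; apply: (fintype.subset_trans (IH _)); exact: (finset.bigcup_sup e).
by apply/bigcupsP => e ev; apply: (fintype.subset_trans (IH _)); exact: (finset.bigcup_sup e).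
Qed.

Lemma edge_ballS r r' v : (r <= r')%N -> edge_ball r v \subset edge_ball r' v.
Proof.
move=> /subnK <-; elim: (r' - r)%N => [|d IH]; first by rewrite add0n.
by rewrite addSn; apply: (fintype.subset_trans IH); exact: edge_ball_mono.
Qed.

Section one_copy.
Variables (S : {set 'I_n}) (F : {set edge m n}) (phi : {ffun V -> 'I_n}).
Hypothesis SF : is_subgraph w S F.
Hypothesis phiS : phi @: [set: V]%SET = S.
Hypothesis phiF : forall x y, #|[set e in F | joins w e (phi x) (phi y)]%SET| = L x y.

Let phi_mem x : phi x \in S.
Proof. by rewrite -phiS imset_f. Qed.

Let phi_ex v : v \in S -> exists x, v = phi x.
Proof. by rewrite -phiS => /imsetP[x _ ->]; exists x. Qed.

Let F_mem e : e \in F -> (src e \in S) /\ (tgt e \in S).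
Proof. by move=> eF; have /forall_inP/(_ e eF)/andP := SF. Qed.

Let adj_edge x y : L x y -> exists e, e \in F /\ joins w e (phi x) (phi y).
Proof.
move=> Lxy; have : (0 < #|[set e in F | joins w e (phi x) (phi y)]%SET|)%N.
  by rewrite phiF Lxy.
by case/card_gt0P => e; rewrite inE => /andP[]; exists e.
Qed.

Lemma copy_card : (#|F| <= #|V| ^ 2)%N.
Proof.
apply: (@leq_trans #|(\bigcup_(xy : V * V) [set e in F | joins w e (phi xy.1) (phi xy.2)])%SET|).
  apply/subset_leq_card/fintype.subsetP => e eF.
  have [/phi_ex[x xE] /phi_ex[y yE]] := F_mem eF.
  by apply/bigcupP; exists (x, y) => //; rewrite inE eF /joins xE yE !eqxx.
rewrite (leq_trans (leq_card_bigcup _ _))//.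
apply: (@leq_trans (\sum_(xy : V * V) 1)); last by rewrite sum1_card card_prod mulnn.
by apply: leq_sum => -[x y] _; rewrite phiF; case: (L _ _).
Qed.

Lemma copy_path_ball p x : path L x p ->
  incident (phi (last x p)) \subset edge_ball (size p) (phi x).
Proof.
elim: p x => // y p IH x /= /andP[Lxy /IH Hp].
have [e [eF]] := adj_edge Lxy.
rewrite /joins => /orP[/andP[/eqP ex /eqP ey]|/andP[/eqP ex /eqP ey]].
  apply: (fintype.subset_trans Hp); apply: (fintype.subset_trans _ (finset.subsetUl _ _)).
  apply: (fintype.subset_trans _ (finset.subsetUr _ _)).
  by rewrite -ey; apply: (finset.bigcup_sup e); rewrite ?ex.
apply: (fintype.subset_trans Hp); apply: (fintype.subset_trans _ (finset.subsetUr _ _)).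
by rewrite -ex; apply: (finset.bigcup_sup e); rewrite ?ey.
Qed.

Lemma copy_subset_ball e0 : e0 \in F -> F \subset edge_ball #|V| (src e0).
Proof.
move=> e0F; have [/phi_ex[x0 x0E] _] := F_mem e0F.
apply/fintype.subsetP => e eF; have [/phi_ex[x xE] _] := F_mem eF.
have /connectP[p0 Lp0] := Lc x0 x; case/shortenP: Lp0 => p Lp up _ lp.
have sp : (size p <= #|V|)%N.
  by have := max_card (mem (x0 :: p)); rewrite (card_uniqP up) => /ltnW.
rewrite x0E; apply: (fintype.subsetP (edge_ballS _ sp)).
apply: (fintype.subsetP (copy_path_ball Lp)).
by rewrite -lp inE xE eqxx.
Qed.

(** A connected graph with an edge has no isolated vertex, so such a copy is determined by its edge
    set and counting edge sets suffices. *)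
Lemma copy_vertices e0 : e0 \in F ->
  S = [set v | [exists e in F, (src e == v) || (tgt e == v)]].
Proof.
move=> e0F; apply/setP => v; rewrite inE; apply/idP/idP; last first.
  by case/exists_inP => e eF /orP[/eqP <-|/eqP <-]; have [] := F_mem eF.
move=> /phi_ex[x ->].
have [ex|ex] := eqVneq (phi x) (src e0).
  by apply/exists_inP; exists e0; rewrite // ex eqxx.
have [/phi_ex[x0 x0E] _] := F_mem e0F.
have /connectP[[|y p]/= Lp lp] := Lc x x0.
  by rewrite x0E lp eqxx in ex.
have [e [eF jo]] : exists e, e \in F /\ joins w e (phi x) (phi y).
  by apply: adj_edge; case/andP: Lp.
apply/exists_inP; exists e => //; move: jo.
by rewrite /joins => /orP[/andP[->]|/andP[_ ->]]; rewrite ?orbT.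
Qed.

End one_copy.

Lemma is_copyP a : is_copy a -> exists phi : {ffun V -> 'I_n},
  [/\ is_subgraph w a.1 a.2, phi @: [set: V]%SET = a.1 &
   forall x y, #|[set e in a.2 | joins w e (phi x) (phi y)]%SET| = L x y].
Proof.
case/andP => sub /existsP[phi /and3P[_ /eqP pS /forallP h]].
by exists phi; split => // x y; have /forallP/(_ y)/eqP := h x.
Qed.

Lemma is_copy_card a : is_copy a -> (#|a.2| <= #|V| ^ 2)%N.
Proof. by case/is_copyP => phi [sub pS pF]; exact: (copy_card sub pS pF). Qed.

(** The edge set of a copy through [e0] is a subset of [E] with at most [#|V| ^ 2] elements. The
    factor [(#|V| ^ 2).+1] counts the possible sizes, and each size is bounded by a binomial
    coefficient. *)
Lemma copies_through_edge_le e0 :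
  (#|[set a | is_copy a && (e0 \in a.2)]%SET| <=
   (#|V| ^ 2).+1 * ball src tgt #|V| (src e0) ^ (#|V| ^ 2))%N.
Proof.
set A := [set a | _]%SET; set k := (#|V| ^ 2)%N; set E := edge_ball #|V| (src e0).
have inj : {in A &, injective snd}.
  move=> [S F] [S' F'] /=; rewrite !inE/= => /andP[c e0F] /andP[c' e0F'] FF'.
  have [phi [sub pS pF]] := is_copyP c; have [phi' [sub' pS' pF']] := is_copyP c'.
  rewrite /= in sub pS pF sub' pS' pF'.
  by rewrite (copy_vertices sub pS pF e0F) (copy_vertices sub' pS' pF' e0F') FF'.
rewrite -(card_in_imset inj).
apply: (@leq_trans #|(\bigcup_(j < k.+1) [set F : {set edge m n} | (F \subset E) && (#|F| == j)])%SET|).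
  apply/subset_leq_card/fintype.subsetP => F /imsetP[[S F'] + ->] /=.
  rewrite inE/= => /andP[c e0F].
  have [phi [sub pS pF]] := is_copyP c; rewrite /= in sub pS pF.
  have Fk : (#|F'| < k.+1)%N by rewrite ltnS; exact: (is_copy_card c).
  apply/bigcupP; exists (Ordinal Fk) => //; rewrite inE eqxx andbT.
  exact: (copy_subset_ball sub pS pF e0F).
apply: (leq_trans (leq_card_bigcup _ _)).
rewrite -[X in (_ <= X * _)%N](card_ord k.+1) -sum_nat_const.
apply: leq_sum => j _; rewrite cards_draws (leq_trans (bin_le_expn _ _))//.
have bE := card_edge_ball #|V| (src e0).
apply: (@leq_trans (ball src tgt #|V| (src e0) ^ j)).
  by case: (nat_of_ord j) => // j'; rewrite leq_exp2r.
rewrite leq_pexp2l//; first by rewrite (leq_trans _ bE).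
by rewrite -ltnS ltn_ord.
Qed.

End copies_through_edge.

(** * Moments of the degrees *)

Section product_expectation.
Context {R : realType} {m n : nat}.

Lemma Ex_indic (A : set (outcome m n)) : (Ex (\1_A : _ -> R))%:E = attach_prob R m n A.
Proof. by rewrite -integral_attach_prob integral_indic// setIT. Qed.

Lemma Ex_prod (r : seq (edge m n)) (G : edge m n -> outcome m n -> R) :
  uniq r -> (forall e, determined [set e]%SET (G e)) ->
  Ex (fun w => \prod_(e <- r) G e w) = \prod_(e <- r) Ex (G e).
Proof.
move=> + GF; elim: r => [_|e r IH /= /andP[er ur]].
  by rewrite big_nil (@eq_Ex _ _ _ _ (fun=> 1)) ?Ex_cst// => w; rewrite big_nil.
rewrite big_cons -IH// -(@Ex_indep _ _ _ [set e]%SET).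
- by apply: eq_Ex => w; rewrite big_cons.
- exact: GF.
- move=> w w' ww'; apply: eq_big_seq => e' e'r; apply: GF => e''.
  rewrite inE => /eqP ->; apply: ww'; rewrite !inE.
  by apply: contraNneq er => <-.
Qed.

(** Equality holds when [v] is older than the source; otherwise the left side is 0. *)
Lemma Ex_edge_target_le (e : edge m n) (v : 'I_n) :
  Ex (fun w => (edge_target w e == v)%:R : R) <= (edge_source e)%:R^-1.
Proof.
have [/existsP[w0 /eqP w0v]|no] := boolP [exists w0, edge_target w0 e == v]; last first.
  rewrite (@eq_Ex _ _ _ _ (fun=> 0)) ?Ex_cst ?invr_ge0// => w.
  by move: no; rewrite negb_exists => /forallP/(_ w)/negbTE ->.
pose A := [set w : outcome m n | forall e', e' \in [set e]%SET -> w e' = w0 e'].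
have -> : Ex (fun w => (edge_target w e == v)%:R : R) = Ex (\1_A).
  apply: eq_Ex => w; rewrite indicE -w0v; congr (nat_of_bool _)%:R.
  apply/eqP/idP => [E|]; rewrite inE /A/=.
    move=> e'; rewrite inE => /eqP ->; apply: val_inj.
    exact: (congr1 val E).
  by move=> /(_ e (set11 e)) E; apply: val_inj; rewrite /= E.
by rewrite -lee_fin Ex_indic (attach_prob_cylinder [set e]%SET w0) big_set1.
Qed.

End product_expectation.

Section exponential_moments.
Context {R : realType}.
Implicit Types (b x : R).

(** Induction on [q] with [b] split as [c * c]: one [c] absorbs the power [q] and the other the
    additional linear factor. *)
Lemma poly_le_expr b q : 1 < b ->
  exists C, 0 <= C /\ forall d : nat, d.+1%:R ^+ q <= C * b ^+ d.
Proof.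
elim: q b => [|q IH] b b1.
  by exists 1; split => // d; rewrite expr0 mul1r exprn_ege1// ltW.
pose c := Num.sqrt b.
have c1 : 1 < c by rewrite -[1]sqrtr1 ltr_sqrt// (lt_trans _ b1).
have cc : c * c = b by rewrite -expr2 sqr_sqrtr// (le_trans _ (ltW b1)).
have [C1 [C10 C1le]] := IH c c1.
(* Chosen so that [C2 * (c - 1) >= 1]: each increment of [C2 * c ^+ d] is then at least 1. *)
pose C2 := 1 + (c - 1)^-1.
have C20 : 0 <= C2 by rewrite addr_ge0// invr_ge0 subr_ge0 ltW.
have C2le (d : nat) : d.+1%:R <= C2 * c ^+ d.
  elim: d => [|d IHd]; first by rewrite expr0 mulr1 lerDl invr_ge0 subr_ge0 ltW.
  have cd1 : 1 <= c ^+ d by rewrite exprn_ege1// ltW.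
  have C2c : 1 <= C2 * (c - 1).
    by rewrite mulrDl mulVf ?mul1r ?gt_eqF ?subr_gt0// lerDr subr_ge0 ltW.
  have : 1 <= C2 * (c - 1) * c ^+ d by exact: mulr_ege1.
  have -> : C2 * c ^+ d.+1 = C2 * c ^+ d + C2 * (c - 1) * c ^+ d by rewrite exprS; ring.
  by rewrite -natr1; lra.
exists (C1 * C2); split; first exact: mulr_ge0.
move=> d; rewrite exprS mulrC -cc exprMn.
have -> : C1 * C2 * (c ^+ d * c ^+ d) = (C1 * c ^+ d) * (C2 * c ^+ d) by ring.
by apply: ler_pM => //; exact: exprn_ge0.
Qed.

(** A reverse Bernoulli inequality: while [k * x] stays below one half, doubling the slope absorbs
    the higher order terms. *)
Lemma expr1D_le x (m k : nat) : 0 <= x -> 2 * m%:R * x <= 1 -> (k <= m)%N ->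
  (1 + x) ^+ k <= 1 + 2 * k%:R * x.
Proof.
move=> x0 mx; elim: k => [_|k IH km]; first by rewrite expr0 mulr0 mul0r addr0.
have kx : 2 * k%:R * x <= 1.
  by apply: le_trans mx; rewrite ler_wpM2r// ler_wpM2l// ler_nat ltnW.
rewrite exprSr (le_trans (ler_wpM2r _ (IH (ltnW km))))//; first by rewrite addr_ge0.
have := ler_wpM2r x0 kx; rewrite -natr1; nra.
Qed.

(* A bound on [E b^(indegree v)], for [b = 1 + 1 / (4 m)] where [m] is the number
   of edges going out of a vertex. *)
Definition growth n v : R := \prod_(v.+1 <= j < n) (1 + (2 * j%:R)^-1).

(** [growth n v] is of order [sqrt (n / v)], whose sum over [v] is of order [n]. The induction step
    is an identity: [2 n (1 + 1 / (2 n)) + 1 = 2 (n + 1)]. *)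
Lemma sum_growth n : \sum_(v < n) growth n v <= 2 * n%:R.
Proof.
elim: n => [|n IH]; first by rewrite big_ord0 mulr0.
rewrite big_ord_recr/= [X in _ + X]/growth big_geq//.
rewrite (eq_bigr (fun v : 'I_n => growth n v * (1 + (2 * n%:R)^-1))); last first.
  by move=> v _; rewrite /growth big_nat_recr/=.
rewrite -mulr_suml.
case: n IH => [|n] IH; first by rewrite big_ord0 mul0r; lra.
apply: (@le_trans _ _ (2 * n.+1%:R * (1 + (2 * n.+1%:R)^-1) + 1)).
  by rewrite lerD2r ler_wpM2r// addr_ge0// invr_ge0 mulr_ge0.
by rewrite mulrDr mulfV ?mulr1 ?mulf_neq0 ?pnatr_eq0// -[n.+2%:R]natr1; lra.
Qed.

End exponential_moments.

Section degree_moments.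
Context {R : realType}.
Variable m : nat.
Hypothesis m0 : (0 < m)%N.
(** With this value [2 * m * (s / j) = 1 / (2 j)], so [expr1D_le] bounds the [m] edges going out of
    [j] together by exactly one factor of [growth]. *)
Let s : R := (4 * m%:R)^-1.
Let b : R := 1 + s.

Let s0 : 0 < s.
Proof. by rewrite invr_gt0 mulr_gt0// ltr0n. Qed.

Let b1 : 1 < b.
Proof. by rewrite ltrDl. Qed.

Lemma outdegree_le n (j : 'I_n) : (#|[pred e : edge m n | edge_source e == j]| <= m)%N.
Proof.
have inj : {in [pred e : edge m n | edge_source e == j] &, injective snd}.
  move=> [e1 a1] [e2 a2]; rewrite !inE/= /edge_source/= => /eqP E1 /eqP E2 ->.
  by congr pair; apply: val_inj; exact: etrans E1 (esym E2).
by rewrite -(card_in_image inj) (leq_trans (max_card _))// card_ord.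
Qed.

(** The power of [b] is a product over independent edges. An edge going out of [j] contributes at
    most [1 + s / j] if [j] is younger than [v], and 1 otherwise. *)
Lemma Ex_indegree_le n (v : 'I_n) :
  Ex (fun w : outcome m n => b ^+ #|[pred e | edge_target w e == v]|) <= growth n v.
Proof.
pose G e (w : outcome m n) : R := if edge_target w e == v then b else 1.
rewrite (@eq_Ex _ _ _ _ (fun w => \prod_(e <- index_enum (edge m n)) G e w)); last first.
  by move=> w; rewrite -big_mkcond/= prodr_const.
rewrite Ex_prod ?index_enum_uniq//; last first.
  move=> e w w' ww'; rewrite /G; congr (if _ == _ then _ else _).
  by apply: val_inj; rewrite /= ww'// set11.
pose H (j : 'I_n) : R := if (v < j)%N then 1 + s / j%:R else 1.
have H1 j : 1 <= H j.
  by rewrite /H; case: ifP => // _; rewrite lerDl divr_ge0// ltW.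
apply: (@le_trans _ _ (\prod_(e : edge m n) H (edge_source e))).
  apply: ler_prod => e _; apply/andP; split.
    by apply: Ex_ge0 => w; rewrite /G; case: ifP => // _; rewrite (le_trans _ (ltW b1)).
  have GE w : G e w = 1 + s * (edge_target w e == v)%:R.
    by rewrite /G; case: eqP => _; rewrite ?mulr1 ?mulr0 ?addr0.
  rewrite (eq_Ex GE) ExD Ex_cst ExZ /H; case: ifP => vj.
    by rewrite lerD2l ler_wpM2l ?(ltW s0)//; exact: Ex_edge_target_le.
  rewrite (@eq_Ex _ _ _ _ (fun=> 0)) ?Ex_cst ?mulr0 ?addr0// => w.
  case: eqP => // E; have := ltn_ord (w e); move/negbT: vj; rewrite -leqNgt -E /=.
  by move=> le lt; have := leq_trans lt le; rewrite ltnn.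
rewrite (partition_big (@edge_source m n) xpredT)//=.
pose K (j : 'I_n) : R := if (v < j)%N then 1 + (2 * j%:R)^-1 else 1.
have KE : growth n v = \prod_j K j by rewrite /growth big_geq_mkord big_mkcond.
rewrite KE {KE}/K.
apply: ler_prod => j _; apply/andP; split.
  by apply: prodr_ge0 => e _; rewrite (le_trans _ (H1 _)).
rewrite (eq_bigr (fun=> H j)); last by move=> e /eqP ->.
rewrite prodr_const (@le_trans _ _ (H j ^+ m))//.
  by rewrite ler_weXn2l// outdegree_le.
rewrite /H; case: ifP => vj; last by rewrite expr1n.
have j0 : 0 < j%:R :> R by rewrite ltr0n (leq_trans _ vj).
have mn0 : 0 < m%:R :> R by rewrite ltr0n.
have E : 2 * m%:R * (s / j%:R) = (2 * j%:R)^-1.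
  by rewrite /s; field; rewrite !gt_eqF.
rewrite (le_trans (@expr1D_le _ _ m m _ _ _))//; last by rewrite E.
  by rewrite divr_ge0// ltW.
rewrite E invf_le1 ?mulr_gt0//.
have : 1 <= j%:R :> R by rewrite ler1n -(ltr0n R).
by lra.
Qed.

(** In the constant, [C] trades the power for an exponential, [b ^+ m] pays for the out-degree, and
    2 comes from [sum_growth]. *)
Lemma Ex_deg_moment_le q : exists C : R, 0 <= C /\ forall n,
  Ex (fun w : outcome m n => (deg_moment (@edge_source m n) (edge_target w) q)%:R) <= C * n%:R.
Proof.
have [C [C0 Cle]] := poly_le_expr q b1.
exists (C * b ^+ m * 2); split.
  by rewrite !mulr_ge0// exprn_ge0// (le_trans _ (ltW b1)).
move=> n; have -> : C * b ^+ m * 2 * n%:R = C * b ^+ m * (2 * n%:R) by ring.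
have Cb0 : 0 <= C * b ^+ m by rewrite mulr_ge0// exprn_ge0// (le_trans _ (ltW b1)).
rewrite (le_trans _ (ler_wpM2l Cb0 (sum_growth n)))// mulr_sumr.
rewrite (@eq_Ex _ _ _ _ (fun w : outcome m n => \sum_(v < n)
  (deg (@edge_source m n) (edge_target w) v).+1%:R ^+ q)); last first.
  by move=> w; rewrite /deg_moment natr_sum; apply: eq_bigr => v _; rewrite natrX.
rewrite Ex_sum; apply: ler_sum => v _.
rewrite (le_trans _ (ler_wpM2l Cb0 (Ex_indegree_le v)))// -ExZ.
apply: le_Ex => w; rewrite (le_trans (Cle _))// -mulrA ler_wpM2l// -exprD.
by rewrite ler_weXn2l ?(ltW b1)// leq_add2r outdegree_le.
Qed.

End degree_moments.

Section load_moments.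
Context {R : realType}.
Variables (m t : nat).
Hypotheses (m0 : (0 < m)%N) (t0 : (0 < t)%N).

(* The copy [a] only inspects the choices of the edges in [copy_edges a]; the
   pairs with too many edges, which are never copies, are given no edge. *)
Definition copy_edges n (V : finType) (a : {set 'I_n} * {set edge m n}) : {set edge m n} :=
  if (#|a.2| <= #|V| ^ 2)%N then a.2 else finset.set0.

Definition copy_ind n (V : finType) (L : rel V) a (w : outcome m n) : R := (is_copy w L a)%:R.

Lemma copy_edges_card n (V : finType) (a : {set 'I_n} * {set edge m n}) :
  (#|copy_edges V a| <= #|V| ^ 2)%N.
Proof. by rewrite /copy_edges; case: ifP => // _; rewrite cards0. Qed.

Lemma copy_ind_determined n (V : finType) (L : rel V) (a : {set 'I_n} * {set edge m n}) :
  determined (copy_edges V a) (copy_ind L a).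
Proof.
move=> w w' ww'; congr (nat_of_bool _)%:R; move: ww'; rewrite /copy_edges.
case: leqP => [_ ww'|big _]; last first.
  by apply/idP/idP => /is_copy_card; rewrite leqNgt big.
have tE e : e \in a.2 -> edge_target w e = edge_target w' e.
  by move=> ea; apply: val_inj; rewrite /= ww'.
congr (_ && _).
  by apply: eq_forallb => e; case: (boolP (e \in a.2)) => //= ea; rewrite tE.
apply: eq_existsb => phi; congr [&& _, _ & _].
apply: eq_forallb => x; apply: eq_forallb => y; congr (_ == _).
apply: eq_card => e; rewrite !inE; case: (boolP (e \in a.2)) => //= ea.
by rewrite /joins tE.
Qed.

Lemma sum_copy_ind n (V : finType) (L : rel V) (w : outcome m n) :
  \sum_a copy_ind L a w = copies R L w.
Proof.
rewrite /copies /num_copies -sum1_card natr_sum [RHS]big_mkcond/=.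
by apply: eq_bigr => a _; rewrite inE /copy_ind /is_copy; case: (_ && _).
Qed.

Lemma edge_load_le n (V : finType) (L : rel V) (e : edge m n) (w : outcome m n) :
  (forall x y, connect L x y) ->
  edge_load (@copy_edges n V) (@copy_ind n V L) e w <=
  ((#|V| ^ 2).+1 * ball (@edge_source m n) (edge_target w) #|V| (edge_source e) ^ (#|V| ^ 2))%:R.
Proof.
move=> Lc; apply: le_trans (_ : #|[set a | is_copy w L a && (e \in a.2)]%SET|%:R <= _); last first.
  by rewrite ler_nat; exact: copies_through_edge_le.
rewrite -sum1_card natr_sum /edge_load [leRHS]big_mkcond [leLHS]big_mkcond/=.
apply: ler_sum => a _; rewrite inE /copy_ind /copy_edges.
case: (leqP #|a.2| _) => [_|big]; last by rewrite finset.in_set0; case: ifP.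
by case: (is_copy w L a); case: (e \in a.2).
Qed.

Lemma edge_load_moment : exists C : R, 0 <= C /\
  forall n (V : finType) (L : rel V), #|V| = t -> (forall x y, connect L x y) ->
    \sum_e Ex (fun w => edge_load (@copy_edges n V) (@copy_ind n V L) e w ^+ 3) <= C * n%:R.
Proof.
(* A load is at most a constant times the [k]-th power of a ball, so its cube calls for the ball
   moment of order [k * 3 = p.+1]. *)
pose k := (t ^ 2)%N; pose p := (k * 3).-1.
have pE : (k * 3)%N = p.+1 by rewrite prednK// muln_gt0 expn_gt0 t0.
pose K := (ball_const t p).1; pose q := (ball_const t p).2.
have [C [C0 Cle]] := @Ex_deg_moment_le R m m0 q.
exists (m%:R * k.+1%:R ^+ 3 * K%:R * C); split; first by rewrite !mulr_ge0// exprn_ge0.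
move=> n V L Vt Lc; rewrite -[leRHS]mulrA.
have mkK0 : 0 <= m%:R * k.+1%:R ^+ 3 * K%:R :> R by rewrite !mulr_ge0// exprn_ge0.
apply: le_trans (ler_wpM2l mkK0 (Cle n)); rewrite -Ex_sum -ExZ; apply: le_Ex => w.
pose B v := ball (@edge_source m n) (edge_target w) t v.
apply: (@le_trans _ _ (\sum_(e : edge m n) k.+1%:R ^+ 3 * (B (edge_source e) ^ p.+1)%:R)).
  apply: ler_sum => e _.
  have := edge_load_le e w Lc; rewrite Vt -/k -/(B _) => le.
  rewrite -pE expnM natrX -exprMn -natrM.
  rewrite lerXn2r ?nnegrE//.
  by apply: sumr_ge0 => a _.
rewrite -mulr_sumr (partition_big (@edge_source m n) xpredT)//=.
apply: (@le_trans _ _ (k.+1%:R ^+ 3 * \sum_v m%:R * (B v ^ p.+1)%:R)).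
  rewrite ler_wpM2l ?exprn_ge0//; apply: ler_sum => v _.
  rewrite (eq_bigr (fun=> (B v ^ p.+1)%:R)); last by move=> e /eqP ->.
  by rewrite sumr_const -[leLHS]mulr_natl ler_wpM2r// ler_nat outdegree_le.
rewrite -mulr_sumr; have := ball_moment t p (@edge_source m n) (edge_target w).
rewrite -(ler_nat R) natr_sum natrM -/K -/q => /(ler_wpM2l (_ : 0 <= m%:R * k.+1%:R ^+ 3 :> R)).
rewrite mulr_ge0 ?exprn_ge0// => /(_ isT).
set X := k.+1%:R ^+ 3; set Y := \sum_ _ _.
by rewrite mulrA (_ : m%:R * X * Y = X * (m%:R * Y)); last by ring.
Qed.

End load_moments.

(** * A lower bound on the mean *)

Section tree_order.
Variables (V : finType) (L : rel V).
Hypothesis LT : is_tree L.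

Let Ls : symmetric L. Proof. by case: LT. Qed.
Let Li : irreflexive L. Proof. by case: LT. Qed.
Let Lc x y : connect L x y. Proof. by case: LT. Qed.
Let La c : ucycle L c -> (size c <= 2)%N. Proof. by case: LT => _ _ _; apply. Qed.

Definition restr (s : seq V) : rel V := [rel x y | [&& L x y, x \in s & y \in s]].

Lemma restr_path s x p : path (restr s) x p -> path L x p && all (mem s) p.
Proof.
elim: p x => //= y p IH x /andP[/and3P[Lxy _ ys] /IH/andP[-> ->]].
by rewrite Lxy ys.
Qed.

(* Two neighbours of [x] inside a connected set avoiding [x] would close a cycle. *)
Lemma tree_neighbor_uniq s x y z : x \notin s -> y \in s -> z \in s ->
  connect (restr s) y z -> L x y -> L x z -> y = z.
Proof.
move=> xs ys zs /connectP[p0 yp0]; case/shortenP: yp0 => p yp up _ zE Lxy Lxz.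
have /andP[Lp sp] := restr_path yp.
case: p => [|y' p] in yp up zE Lp sp *; first by rewrite zE.
suff /La : ucycle L [:: x, y, y' & p] by [].
apply/andP; split.
  rewrite /= Lxy/=; move: Lp; rewrite /= rcons_path => /andP[-> ->] /=.
  by rewrite Ls; move: zE => /= <-.
rewrite cons_uniq up andbT.
by apply: contra xs; rewrite inE => /predU1P[->//|]; exact: (allP sp).
Qed.

(** Otherwise [s] would be closed under [L], and connectedness would make it everything. *)
Lemma tree_exit (s : seq V) y0 : y0 \in s -> (size s < #|V|)%N -> exists x y,
  [/\ x \notin s, y \in s & L x y].
Proof.
move=> y0s ss; have [/existsP[x /existsP[y /and3P[]]]|] :=
  boolP [exists x, exists y, [&& x \notin s, y \in s & L x y]]; first by exists x, y.
rewrite negb_exists => /forallP no.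
have cl : fingraph.closed L (mem s).
  have H x y : L x y -> x \in s -> y \in s.
    move=> Lxy xs; apply: contraT => ys.
    by have := no y; rewrite negb_exists => /forallP/(_ x); rewrite ys Ls Lxy xs.
  by move=> x y Lxy; apply/idP/idP; [exact: H|apply: H; rewrite Ls].
have : (#|V| <= size s)%N.
  rewrite cardE -(card_uniqP (enum_uniq V)); apply: leq_trans (card_size s).
  by apply/subset_leq_card/fintype.subsetP => x _; rewrite -(closed_connect cl (Lc y0 x)).
by rewrite leqNgt ss.
Qed.

(** The order is grown one vertex at a time, each new vertex being adjacent to the current set;
    acyclicity makes its neighbour there unique. The induction also carries connectedness inside the
    current set, which [tree_neighbor_uniq] requires. *)
Lemma tree_order : (0 < #|V|)%N -> exists s : seq V,
  [/\ uniq s, size s = #|V| &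
    forall i x0, (0 < i < #|V|)%N -> exists2 j, (j < i)%N &
      forall l, (l < i)%N -> L (nth x0 s i) (nth x0 s l) = (l == j)].
Proof.
move=> /card_gt0P[v0 _].
suff /(_ #|V|.-1) : forall k, (k.+1 <= #|V|)%N -> exists s : seq V,
    [/\ uniq s, size s = k.+1, {in s &, forall y z, connect (restr s) y z} &
      forall i x0, (0 < i < k.+1)%N -> exists2 j, (j < i)%N &
        forall l, (l < i)%N -> L (nth x0 s i) (nth x0 s l) = (l == j)].
  have V0 : (0 < #|V|)%N by apply/card_gt0P; exists v0.
  by rewrite prednK// => /(_ (leqnn _))[s [us ss _ h]]; exists s.
elim=> [_|k IH kV].
  exists [:: v0]; split => //; last by case.
  by move=> y z; rewrite !inE => /eqP -> /eqP ->.
have [s [us ss cs hs]] := IH (ltnW kV).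
have [y0 y0s] : exists y, y \in s by case: s ss {us cs hs} => // y s _; exists y; rewrite inE eqxx.
have [|x [y [xs ys Lxy]]] := tree_exit y0s; first by rewrite ss.
exists (rcons s x); split.
- by rewrite rcons_uniq xs.
- by rewrite size_rcons ss.
- have sub a b : a \in s -> b \in s -> connect (restr (rcons s x)) a b.
    move=> /cs h /h; apply: connect_sub => c d /and3P[Lcd c_s d_s].
    by apply: connect1; rewrite /restr/= Lcd !mem_rcons !inE c_s d_s !orbT.
  have xy : restr (rcons s x) x y by rewrite /restr/= Lxy !mem_rcons !inE eqxx ys orbT.
  have yx : restr (rcons s x) y x by rewrite /restr/= Ls Lxy !mem_rcons !inE eqxx ys orbT.
  move=> a b; rewrite !mem_rcons !inE => /predU1P[->|a_s] /predU1P[->|b_s] //.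
  + by apply: connect_trans (connect1 xy) _; exact: sub.
  + by apply: connect_trans _ (connect1 yx); exact: sub.
  + exact: sub.
- move=> i z0 /andP[i0]; rewrite ltnS leq_eqVlt => /predU1P[->|ik]; last first.
    have [|j ji hj] := hs i z0; first by rewrite i0.
    exists j => // l li; rewrite !nth_rcons ss ik (ltn_trans li ik); exact: hj.
  exists (index y s); first by rewrite -ss index_mem.
  move=> l lk; rewrite !nth_rcons ss ltnn eqxx lk.
  apply/idP/eqP => [Lxl|->]; last by rewrite nth_index.
  have ls : nth z0 s l \in s by rewrite mem_nth// ss.
  by rewrite (tree_neighbor_uniq xs ys ls (cs _ _ ys ls) Lxy Lxl) index_uniq// ss.
Qed.

End tree_order.

Section binomial_growth.

(** Each factor [n - i] of the falling factorial is at least [n / 2], since [i < t]. *)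
Lemma expn_le_bin n t : (2 * t <= n -> n ^ t <= 2 ^ t * t`! * 'C(n, t))%N.
Proof.
move=> tn; rewrite -mulnA [(t`! * _)%N]mulnC bin_ffact ffact_prod.
have E (a : nat) : (a ^ t = \prod_(i < t) a)%N by rewrite prod_nat_const card_ord.
rewrite (E n) (E 2) -big_split/=; apply: leq_prod => i _.
by have := ltn_ord i; lia.
Qed.

End binomial_growth.

Section planted_tree.
Variables (m n : nat) (V : finType) (L : rel V).
Hypotheses (m0 : (0 < m)%N) (V0 : (0 < #|V|)%N) (LT : is_tree L).
Local Open Scope set_scope.

Variable s : seq V.
Hypotheses (us : uniq s) (ss : size s = #|V|).
Hypothesis hs : forall i x0, (0 < i < #|V|)%N -> exists2 j, (j < i)%N &
  forall l, (l < i)%N -> L (nth x0 s i) (nth x0 s l) = (l == j).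

Variables (S : {set 'I_n}) (i0 : 'I_n).
Hypothesis SV : #|S| = #|V|.

Let es := enum S.
Let x0 : V := enum_val (Ordinal V0).
(** The position of the first neighbour in the order, which for [0 < i] is the only earlier one. *)
Let par i := find (L (nth x0 s i)) s.
Let a0 : 'I_m := Ordinal m0.

Let size_es : size es = #|V|. Proof. by rewrite -cardE. Qed.

Let mem_s x : x \in s.
Proof.
have : s =i predT.
  apply/subset_cardP; last exact/fintype.subsetP.
  by rewrite (card_uniqP us) ss; apply: eq_card.
by move=> ->.
Qed.

Let idx_lt x : (index x s < #|V|)%N.
Proof. by rewrite -ss index_mem mem_s. Qed.

Let par_lt i : (0 < i < #|V|)%N -> (par i < i)%N.
Proof.
move=> iV; have [j ji hj] := hs x0 iV.
have js : (j < size s)%N by rewrite ss (ltn_trans ji)//; case/andP: iV.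
rewrite (leq_ltn_trans _ ji)// /par leqNgt; apply/negP => /(before_find x0).
by rewrite hj// eqxx.
Qed.

Let parE i l : (l < i < #|V|)%N -> L (nth x0 s i) (nth x0 s l) = (l == par i).
Proof.
case/andP=> li iV; have i1 : (0 < i < #|V|)%N by rewrite iV (leq_trans _ li).
have [j ji hj] := hs x0 i1.
rewrite hj//; congr (_ == _); have := hj _ (par_lt i1).
rewrite [L _ _]nth_find => [/esym/eqP->//|].
by apply/hasP; exists (nth x0 s j); rewrite ?mem_s// hj// eqxx.
Qed.

Let es_lt i j : (i < j < #|V|)%N -> (nth i0 es i < nth i0 es j)%N.
Proof.
case/andP=> ij jV.
have srt : sorted (relpre val ltn) (enum S).
  rewrite -sorted_map {1}/enum_mem; apply: (subseq_sorted ltn_trans _ (iota_ltn_sorted 0 n)).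
  by rewrite -val_enum_ord; apply: map_subseq; rewrite enumT; exact: filter_subseq.
have tr : transitive (relpre (val : 'I_n -> nat) ltn) by move=> a b c /=; exact: ltn_trans.
apply: (sorted_ltn_nth tr i0 srt) => //; rewrite inE -/es size_es//.
exact: ltn_trans jV.
Qed.

Let es_mem i : (i < #|V|)%N -> nth i0 es i \in S.
Proof. by move=> iV; rewrite -mem_enum mem_nth// size_es. Qed.

Let es_inj i j : (i < #|V|)%N -> (j < #|V|)%N -> nth i0 es i = nth i0 es j -> i = j.
Proof.
by move=> iV jV /eqP; rewrite nth_uniq ?size_es ?enum_uniq// => /eqP.
Qed.

Let phi : {ffun V -> 'I_n} := [ffun x => nth i0 es (index x s)].

Definition planted_edges : {set edge m n} :=
  [set e | [&& edge_source e \in S, edge_source e != nth i0 es 0 & e.2 == a0]].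

(* The vertices of [S], in increasing order, carry the tree vertices in the order
   [s], and each of them but the first chooses its tree parent. *)
Definition planted_choice (e : edge m n) : 'I_(edge_source e) :=
  insubd (Ordinal (valP e.1)) (val (nth i0 es (par (index (edge_source e) es)))).

Let planted_source e : e \in planted_edges ->
  exists2 i, (0 < i < #|V|)%N & edge_source e = nth i0 es i.
Proof.
rewrite inE => /and3P[eS e0 _]; exists (index (edge_source e) es); last first.
  by rewrite nth_index// mem_enum.
apply/andP; split; last by rewrite -size_es index_mem mem_enum.
rewrite lt0n; apply: contraNneq e0 => E.
by rewrite -E nth_index// mem_enum.
Qed.

Let planted_target (w : outcome m n) e i :
  (forall e, e \in planted_edges -> w e = planted_choice e) ->
  e \in planted_edges -> (0 < i < #|V|)%N -> edge_source e = nth i0 es i ->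
  edge_target w e = nth i0 es (par i).
Proof.
move=> we eF iV ei; apply: val_inj; rewrite /= we// /planted_choice.
have -> : index (edge_source e) es = i.
  by rewrite ei index_uniq ?enum_uniq// size_es; case/andP: iV.
rewrite val_insubd ifT// -[X in (_ < X)%N]/(val (edge_source e)) ei.
by apply: es_lt; rewrite par_lt//; case/andP: iV.
Qed.

Let phi_inj : injective phi.
Proof.
move=> x y; rewrite !ffunE => /es_inj; rewrite !idx_lt => /(_ isT isT) E.
by rewrite -(nth_index x (mem_s x)) E nth_index.
Qed.

(** Edges point to older vertices, so an edge joining [phi x] and [phi y] goes out of [phi y]. The
    only planted edge going out of [phi y] leads to the tree parent of [y]. *)
Let count_lt (w : outcome m n) x y :
  (forall e, e \in planted_edges -> w e = planted_choice e) ->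
  (index x s < index y s)%N ->
  #|[set e in planted_edges | joins w e (phi x) (phi y)]| = L y x.
Proof.
move=> we xy; have yV := idx_lt y.
have y1 : (0 < index y s < #|V|)%N by rewrite yV (leq_trans _ xy).
have LE : L y x = (index x s == par (index y s)).
  by rewrite -parE ?xy// !nth_index.
have pxy : (phi x < phi y)%N by rewrite !ffunE es_lt// xy.
have src e : e \in planted_edges -> joins w e (phi x) (phi y) ->
    edge_source e = phi y /\ edge_target w e = phi x.
  move=> eF /orP[/andP[/eqP ex /eqP ey]|/andP[/eqP -> /eqP ->]//].
  have := ltn_ord (w e); rewrite -[X in (X < _)%N]/(val (edge_target w e)).
  by rewrite -[X in (_ < X)%N]/(val (edge_source e)) ex ey ltnNge ltnW.
rewrite LE; case: eqP => [E|NE]; last first.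
  apply/eqP; rewrite cards_eq0 -finset.subset0; apply/fintype.subsetP => e.
  rewrite inE => /andP[eF /(src _ eF)[sy tx]].
  case: NE; apply: es_inj; rewrite ?idx_lt//.
    by rewrite (ltn_trans (par_lt y1)).
  have := planted_target we eF y1; rewrite sy ffunE => /(_ erefl) <-.
  by rewrite tx ffunE.
have y0 : (0 < phi y)%N by rewrite (leq_ltn_trans _ pxy).
pose e : edge m n := (exist _ (phi y) y0, a0).
have eF : e \in planted_edges.
  rewrite inE /edge_source/= eqxx andbT ffunE -mem_enum mem_nth ?size_es//=.
  by apply/eqP => /es_inj; rewrite V0 yV => /(_ isT isT) E0; rewrite E0 in y1.
rewrite (_ : [set _ in _ | _] = [set e]) ?cards1//; apply/setP => e'; rewrite !inE.
apply/andP/eqP => [[e'F je]|->]; last first.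
  split; first by move: eF; rewrite inE.
  have tx : edge_target w e = phi x.
    by rewrite (planted_target we eF y1) -?E ?ffunE// /edge_source/= ffunE.
  by rewrite /joins tx /edge_source/= !eqxx orbT.
have e'F' : e' \in planted_edges by rewrite inE.
have [sy _] := src _ e'F' je.
case: e' sy e'F {e'F' je} => [[j jp] a]; rewrite /edge_source/= => sy /and3P[_ _ /eqP ->].
by congr pair; apply: val_inj; exact: sy.
Qed.

Lemma planted_is_copy (w : outcome m n) :
  (forall e, e \in planted_edges -> w e = planted_choice e) ->
  is_copy w L (S, planted_edges).
Proof.
move=> we; have [Ls Li _ _] := LT; apply/andP; split.
  apply/forall_inP => e eF; have [i iV ei] := planted_source eF.
  have [_ iV'] := andP iV.
  rewrite (planted_target we eF iV ei) ei /= !es_mem//.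
  exact: ltn_trans (par_lt iV) iV'.
apply/existsP; exists phi; apply/and3P; split; first exact/injectiveP.
  rewrite eqEcard card_imset// cardsT SV leqnn andbT.
  by apply/fintype.subsetP => v /imsetP[x _ ->]; rewrite ffunE es_mem.
apply/forallP => x; apply/forallP => y; apply/eqP.
have [xy|yx|E] := ltngtP (index x s) (index y s).
- by rewrite count_lt// Ls.
- rewrite -(count_lt we yx); apply: eq_card => e; rewrite !inE; congr (_ && _).
  by rewrite /joins orbC.
have <- : x = y by rewrite -(nth_index x (mem_s x)) E nth_index.
rewrite Li; apply/eqP; rewrite cards_eq0 -finset.subset0.
apply/fintype.subsetP => e; rewrite inE => /andP[_].
rewrite /joins orbb => /andP[/eqP <- /eqP E']; have := edge_neq w e.
by rewrite E' eqxx.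
Qed.

Lemma planted_edges_card : (#|planted_edges| <= #|V|.-1)%N.
Proof.
have inj : {in planted_edges &, injective (@edge_source m n)}.
  move=> [e1 a1] [e2 a2]; rewrite !inE => /and3P[_ _ /eqP/= ->] /and3P[_ _ /eqP/= ->] E.
  by congr pair; apply: val_inj.
rewrite -(card_in_imset inj) -SV.
rewrite [X in (_ <= X.-1)%N](cardsD1 (nth i0 es 0)) es_mem// add1n/=.
apply/subset_leq_card/fintype.subsetP => v.
by case/imsetP => e; rewrite inE => /and3P[eS e0 _] ->; rewrite !inE e0 eS.
Qed.

End planted_tree.

Section mean_lower_bound.
Context {R : realType}.
Variables (m n : nat) (V : finType) (L : rel V).
Hypotheses (m0 : (0 < m)%N) (V0 : (0 < #|V|)%N) (LT : is_tree L).

Let planted_prob (S : {set 'I_n}) : #|S| = #|V| -> exists F : {set edge m n},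
  n%:R ^- #|V|.-1 <= Ex (@copy_ind R m n V L (S, F)).
Proof.
move=> SV; have [s [us ss hs]] := tree_order LT V0.
have [i0 i0S] : exists i0, i0 \in S by apply/card_gt0P; rewrite SV.
pose F := planted_edges m0 S i0; exists F.
pose v : outcome m n := finfun (fun e => planted_choice L V0 s S i0 e).
have vE e : v e = planted_choice L V0 s S i0 e by rewrite ffunE.
pose A := [set w : outcome m n | forall e, e \in F -> w e = v e].
apply: (@le_trans _ _ (Ex (\1_A : _ -> R))); last first.
  apply: le_Ex => w; rewrite indicE; case: (boolP (w \in A)) => // wA.
  have wF e : e \in F -> w e = planted_choice L V0 s S i0 e.
    by move=> eF; rewrite -vE; move: wA; rewrite inE => /(_ e eF).
  by rewrite /copy_ind (@planted_is_copy m n V L m0 V0 LT s us ss hs S i0 SV w wF).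
rewrite -lee_fin Ex_indic attach_prob_cylinder lee_fin.
have n0 : (0 < n)%N by exact: leq_ltn_trans (leq0n _) (ltn_ord i0).
apply: (@le_trans _ _ (\prod_(e in F) n%:R^-1)).
  rewrite prodr_const exprVn lef_pV2 ?posrE ?exprn_gt0 ?ltr0n//.
  rewrite ler_weXn2l ?ler1n//; exact: planted_edges_card.
apply: ler_prod => e _; rewrite invr_ge0 ler0n/=.
by rewrite lef_pV2 ?posrE ?ltr0n ?(valP e.1)// ler_nat ltnW.
Qed.

Lemma copies_mean_ge : (2 * #|V| <= n)%N ->
  n%:R <= (2 ^ #|V| * (#|V|)`!)%:R * Ex (@copies R m n V L).
Proof.
move=> Vn; have n0 : (0 < n)%N by rewrite (leq_trans _ Vn)// muln_gt0.
set t := #|V| in Vn *.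
suff Cle : 'C(n, t)%:R * n%:R ^- t.-1 <= Ex (@copies R m n V L).
  have := expn_le_bin Vn; rewrite -(ler_nat R) natrM natrX.
  have tE : t = t.-1.+1 by rewrite prednK.
  rewrite {1}tE exprSr => le.
  rewrite (le_trans _ (ler_wpM2l (ler0n _ _) Cle))//.
  by rewrite mulrA ler_pdivlMr ?exprn_gt0 ?ltr0n// mulrC.
rewrite (@eq_Ex _ _ _ _ (fun w => \sum_a copy_ind L a w)); last first.
  by move=> w; rewrite sum_copy_ind.
rewrite Ex_sum.
rewrite -(pair_big xpredT xpredT (fun S F => Ex (@copy_ind R m n V L (S, F))))/=.
have -> : 'C(n, t)%:R * n%:R ^- t.-1 =
    \sum_(S in [set S : {set 'I_n} | #|S| == t]%SET) n%:R ^- t.-1 :> R.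
  by rewrite sumr_const card_draws card_ord -[RHS]mulr_natl.
rewrite big_mkcond/=; apply: ler_sum => S _; rewrite inE.
have X0 F : 0 <= Ex (@copy_ind R m n V L (S, F)) by exact: Ex_ge0.
case: eqP => [/planted_prob[F FS]|_]; last exact: sumr_ge0.
by rewrite (bigD1 F)//= (le_trans FS)// lerDl; exact: sumr_ge0.
Qed.

End mean_lower_bound.

(** * Normal approximation *)

Section copies_upper_bounds.
Context {R : realType}.
Variables (m t : nat).
Hypotheses (m0 : (0 < m)%N) (t0 : (0 < t)%N).

Let load n (V : finType) (L : rel V) (e : edge m n) (w : outcome m n) : R :=
  edge_load (@copy_edges m n V) (@copy_ind R m n V L) e w.

Let load_nat n (V : finType) (L : rel V) (e : edge m n) (w : outcome m n) :
  exists c : nat, load L e w = c%:R.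
Proof.
exists (\sum_(a | e \in copy_edges V a) is_copy w L a)%N.
by rewrite natr_sum.
Qed.

(** Loads are natural numbers, so the cube dominates the lower powers and one moment bound serves
    the mean, the variance and the Stein error. *)
Let load_le3 n (V : finType) (L : rel V) (e : edge m n) (w : outcome m n) p :
  (0 < p <= 3)%N -> load L e w ^+ p <= load L e w ^+ 3.
Proof.
move=> /andP[p0 p3]; have [[|c] ->] := load_nat L e w.
  by case: p p0 p3 => // p _ _; rewrite !expr0n.
by rewrite ler_weXn2l// ler1n.
Qed.

(** A copy without edges forces the tree to be a single vertex. Such copies are invisible to the
    edge loads and account for the term [n%:R] in [copies_le]. *)
Lemma edgeless_copy_le n (V : finType) (L : rel V) (w : outcome m n) : (0 < #|V|)%N ->
  (forall x y, connect L x y) ->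
  (#|[set a | is_copy w L a && (a.2 == finset.set0)]%SET| <= n)%N.
Proof.
move=> /card_gt0P[x _] Lc.
apply: (@leq_trans #|[set ([set v], finset.set0) | v in [set: 'I_n]]%SET : {set {set 'I_n} * {set edge m n}}|).
  apply/subset_leq_card/fintype.subsetP => -[S F]; rewrite inE/=.
  case/andP=> /is_copyP[phi [/= _ pS pF]] /eqP F0.
  subst F; apply/imsetP; exists (phi x); first by rewrite inE.
  congr pair.
  have Vx y : y = x.
    have /connectP[[|z p]/= Lp] := Lc x y; first by [].
    have /andP[Lxz _] := Lp; have := pF x z; rewrite Lxz.
    by rewrite (_ : [set _ in _ | _]%SET = finset.set0) ?cards0//; apply/setP => e; rewrite !inE.
  rewrite -pS; apply/setP => v; rewrite !inE; apply/imsetP/eqP => [[y _ ->]|->]; last by exists x.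
  by rewrite (Vx y).
by rewrite (leq_trans (leq_imset_card _ _))// cardsT card_ord.
Qed.

Lemma copies_le n (V : finType) (L : rel V) (w : outcome m n) : (0 < #|V|)%N ->
  (forall x y, connect L x y) -> copies R L w <= n%:R + \sum_e load L e w.
Proof.
move=> V0 Lc; rewrite -sum_copy_ind.
have -> : \sum_e load L e w = \sum_a \sum_(e in copy_edges V a) copy_ind L a w.
  by rewrite /load /edge_load (exchange_big_dep xpredT).
rewrite (bigID (fun a => a.2 == finset.set0))/=; apply: lerD.
  apply: le_trans (_ : #|[set a | is_copy w L a && (a.2 == finset.set0)]%SET|%:R <= _); last first.
    by rewrite ler_nat edgeless_copy_le.
  rewrite -sum1_card natr_sum [leRHS]big_mkcond [leLHS]big_mkcond/=.
  by apply: ler_sum => a _; rewrite inE /copy_ind; case: (is_copy _ _ _); case: (_ == _).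
rewrite [leLHS]big_mkcond/=; apply: ler_sum => a _.
rewrite sumr_const; case: eqP => [_|/eqP a0]; first exact: mulrn_wge0.
rewrite /copy_ind; case: (boolP (is_copy w L a)) => [ca|_]; last by rewrite mul0rn.
by rewrite /copy_edges (is_copy_card ca) ler1n lt0n cards_eq0.
Qed.

Lemma copies_moments : exists C : R, 0 <= C /\
  forall n (V : finType) (L : rel V), #|V| = t -> (forall x y, connect L x y) ->
  [/\ copies_mean R m n L <= C * n%:R, copies_var R m n L <= C * n%:R &
      \sum_(e : edge m n) Ex (fun w => load L e w ^+ 3) <= C * n%:R].
Proof.
have [C [C0 Cle]] := @edge_load_moment R m t m0 t0.
exists (C + 1); split; first by rewrite addr_ge0.
move=> n V L Vt Lc; have C3 := Cle n V L Vt Lc.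
have C1n : C * n%:R <= (C + 1) * n%:R by rewrite ler_wpM2r// lerDl.
split; last exact: le_trans C1n.
- rewrite copies_meanE mulrDl mul1r addrC.
  apply: le_trans (lerD (lexx _) C3).
  rewrite -Ex_sum -[n%:R](@Ex_cst R m n) -ExD; apply: le_Ex => w.
  rewrite (le_trans (copies_le _ _ _)) ?Vt// lerD2l; apply: ler_sum => e _.
  by rewrite -[leLHS]expr1; exact: load_le3.
- rewrite copies_varE; apply: le_trans C1n; apply: le_trans C3.
  pose W (w : outcome m n) : R := \sum_a copy_ind L a w.
  have E (w : outcome m n) : W w = copies R L w := sum_copy_ind L w.
  have -> : Ex (fun w : outcome m n => (copies R L w - Ex (@copies R m n V L)) ^+ 2) =
      Ex (fun w => (W w - Ex W) ^+ 2).
    by apply: eq_Ex => w; rewrite E (eq_Ex E).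
  have V2 := @local_variance_le R m n _ (@copy_edges m n V) (@copy_ind R m n V L)
    (fun a w => ler0n _ _) (@copy_ind_determined R m n V L).
  apply: le_trans V2 _; apply: ler_sum => e _; apply: le_Ex => w; exact: load_le3.
Qed.

Lemma copies_std_stein : exists D : R, 0 <= D /\
  forall n (V : finType) (L : rel V), #|V| = t -> (forall x y, connect L x y) ->
  0 < copies_var R m n L ->
  (wasserstein (copies_std_law R m n L) (normal_prob 0 1) <=
    (D * n%:R / Num.sqrt (copies_var R m n L) ^+ 3)%:E)%E.
Proof.
have [C [C0 Cle]] := copies_moments.
(* [7] is the constant of [stein_equation], and [t ^ 2] bounds the number of edges of a copy. *)
exists (56 * 7 * (t ^ 2)%:R * C); split; first by rewrite !mulr_ge0.
move=> n V L Vt Lc v0; have [_ _ C3] := Cle n V L Vt Lc.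
apply: ub_ereal_sup => _ [h /= hL <-].
have mh : measurable_fun [set: measurableTypeR R] h.
  by apply: continuous_measurable_fun; exact: lipschitz1_continuous.
rewrite integral_copies_std_law// integral_normal_prob_lipschitz//.
rewrite -EFinB abse_EFin lee_fin.
have [f [g [fg gL fT]]] := stein_equation hL.
set s := Num.sqrt _; have s0 : 0 < s by rewrite sqrtr_gt0.
pose W (w : outcome m n) : R := \sum_a copy_ind L a w.
have E (w : outcome m n) : W w = copies R L w := sum_copy_ind L w.
have s2 : s ^+ 2 = Ex (fun w => (W w - Ex W) ^+ 2).
  rewrite sqr_sqrtr ?(ltW v0)// copies_varE.
  by apply: eq_Ex => w; rewrite E (eq_Ex E).
have := local_dependence_stein (F := @copy_edges m n V) (X := @copy_ind R m n V L)
  (fun a w => ler0n _ _) (@copy_ind_determined R m n V L) (@copy_edges_card m n V)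
  s0 (ler0n _ 7) s2 gL fT.
rewrite -[Ex _ - normal_mean h]/(Ex _ - _) -[X in Ex _ - X](@Ex_cst R m n) -ExB.
have -> : Ex (fun w => h (@copies_std R m n V L w) - normal_mean h) =
  Ex (fun w => g ((W w - Ex W) / s) -
    (W w - Ex W) / s *
     f ((W w - Ex W) / s)).
  by apply: eq_Ex => w; rewrite E (eq_Ex E) fg /copies_std copies_meanE.
move=> /le_trans; apply; rewrite Vt ler_pM2r ?invr_gt0 ?exprn_gt0//.
by rewrite -[leRHS]mulrA ler_wpM2l// !mulr_ge0.
Qed.

End copies_upper_bounds.

(** * Independence of the vertex type of the tree *)

Section relabelling.
Context {R : realType} {m n : nat}.
Variables (V V' : finType) (L : rel V) (L' : rel V') (f : V -> V').
Hypotheses (fbij : bijective f) (fL : forall x y, L' (f x) (f y) = L x y).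

Lemma subgraph_isom_relabel (w : outcome m n) S F :
  subgraph_isom w L' S F -> subgraph_isom w L S F.
Proof.
case: fbij => g fK gK; case/existsP => phi /and3P[/injectiveP pi /eqP pS /forallP pF].
apply/existsP; exists [ffun x => phi (f x)]; apply/and3P; split.
- by apply/injectiveP => x y; rewrite !ffunE => /pi/(can_inj fK).
- apply/eqP; rewrite -pS; apply/setP => v; apply/imsetP/imsetP => -[x _ ->].
    by exists (f x); rewrite ?ffunE.
  by exists (g x); rewrite ?ffunE ?gK.
- apply/forallP => x; apply/forallP => y; rewrite !ffunE -fL.
  by have /forallP := pF (f x); apply.
Qed.

End relabelling.

Lemma copies_relabel (R : realType) m n (V V' : finType) (L : rel V) (L' : rel V') (f : V -> V') :
  bijective f -> (forall x y, L' (f x) (f y) = L x y) ->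
  @copies R m n V L = @copies R m n V' L'.
Proof.
move=> fb fL; apply/funext => w; congr (_%:R); apply: eq_card => a; rewrite !inE.
congr (_ && _); apply/idP/idP; last exact: (subgraph_isom_relabel fb fL).
case: fb => g fK gK; apply: (@subgraph_isom_relabel _ _ _ _ _ _ g); first by exists f.
by move=> x y; rewrite -fL !gK.
Qed.

Lemma copies_mean_var_growth (R : realType) (m : nat) (V : finType) (L : rel V) :
  (0 < m)%N -> (0 < #|V|)%N -> is_tree L ->
  is_Theta (fun n => copies_mean R m n L) (fun n => n%:R) /\
  ((fun n => copies_var R m n L : R^o) =O_\oo (fun n => n%:R : R^o)).
Proof.
move=> m0 V0 LT; have Lc : forall x y, connect L x y by case: LT.
have [C [C0 Cle]] := @copies_moments R m #|V| m0 V0.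
pose c : R := (2 ^ #|V| * (#|V|)`!)%:R.
have c0 : 0 < c by rewrite ltr0n muln_gt0 expn_gt0 fact_gt0.
split.
  exists c^-1, (c^-1 + C); split; [by rewrite invr_gt0|by rewrite lerDl|].
  near=> n; apply/andP; split; last first.
    have [C1 _ _] := Cle n V L erefl Lc.
    by rewrite (le_trans C1)// ler_wpM2r// lerDr invr_ge0 ltW.
  rewrite mulrC ler_pdivrMr// mulrC copies_meanE.
  apply: copies_mean_ge => //.
  near: n; exact: nbhs_infty_ge.
apply/eqO_exP; exists (C + 1).
  by rewrite (le_lt_trans C0)// ltrDl.
apply: nearW => n; have [_ C2 _] := Cle n V L erefl Lc.
have v0 : 0 <= copies_var R m n L.
  by rewrite copies_varE; apply: Ex_ge0 => w; exact: sqr_ge0.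
rewrite !ger0_norm//= (le_trans C2)// ler_wpM2r// lerDl//.
Unshelve. all: by end_near. Qed.

(** [n / (c n)^(3/2) = c^(-3/2) n^(-1/2)]. [D] is chosen before the tree and the dependence on [c]
    is explicit, so that a uniform constant can be extracted afterwards. *)
Lemma copies_std_wasserstein (R : realType) (m t : nat) : (0 < m)%N -> (0 < t)%N ->
  exists D : R, forall (c : R) (V : finType) (L : rel V), 0 < c -> #|V| = t -> is_tree L ->
  (\forall n \near \oo, c * n%:R <= copies_var R m n L) ->
  \forall n \near \oo,
    (wasserstein (copies_std_law R m n L) (normal_prob 0 1) <=
      (D / Num.sqrt c ^+ 3 * n%:R `^ (- 2^-1))%:E)%E.
Proof.
move=> m0 t0; have [D [D0 Dle]] := @copies_std_stein R m t m0 t0.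
exists D => c V L c0 Vt LT cvar; have Lc : forall x y, connect L x y by case: LT.
near=> n.
have n0 : 0 < n%:R :> R by rewrite ltr0n; near: n; exact: nbhs_infty_gt.
have cn : c * n%:R <= copies_var R m n L by near: n.
have cn0 : 0 < c * n%:R by rewrite mulr_gt0.
have v0 : 0 < copies_var R m n L by exact: lt_le_trans cn.
apply: (le_trans (Dle n V L Vt Lc v0)); rewrite lee_fin powRN powR12_sqrt ?(ltW n0)//.
have sn0 : 0 < Num.sqrt n%:R :> R by rewrite sqrtr_gt0.
have sc0 : 0 < Num.sqrt c by rewrite sqrtr_gt0.
apply: (@le_trans _ _ (D * n%:R / (Num.sqrt c * Num.sqrt n%:R) ^+ 3)).
  rewrite ler_wpM2l ?mulr_ge0// lef_pV2 ?posrE ?exprn_gt0 ?mulr_gt0 ?sqrtr_gt0//.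
  by rewrite lerXn2r ?nnegrE ?mulr_ge0 ?sqrtr_ge0// -sqrtrM ?ler_sqrt// ltW.
rewrite -{1}(sqr_sqrtr (ltW n0)) le_eqVlt; apply/orP; left; apply/eqP.
by field; rewrite !gt_eqF.
Unshelve. all: by end_near. Qed.

Theorem theorem3p7 (R : realType) (m t : nat) (hm : (0 < m)%N) (ht : (0 < t)%N) :
  (forall (V : finType) (L : rel V), #|V| = t -> is_tree L ->
     is_Theta (fun n => copies_mean R m n L) (fun n => n%:R) /\
     ((fun n => copies_var R m n L : R^o) =O_\oo (fun n => n%:R : R^o))) /\
  exists C : R, forall (V : finType) (L : rel V), #|V| = t -> is_tree L ->
    is_Theta (fun n => copies_var R m n L) (fun n => n%:R) ->
    \forall n \near \oo,
      (wasserstein (copies_std_law R m n L) (normal_prob 0 1)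
         <= (C * n%:R `^ (- 2^-1))%:E)%E.
Proof.
split=> [V L Vt LT|]; first by apply: copies_mean_var_growth => //; rewrite Vt.
have [D Dle] := @copies_std_wasserstein R m t hm ht.
(* [C] must precede the tree, whereas the lower variance constant depends on it. Every tree with [t]
   vertices is a relabelling of one of the finitely many relations on ['I_t], so a constant [u l] is
   fixed for each of these, with the dummy value 1 if its variance is not of order [n]. *)
pose rel_of (l : {ffun 'I_t * 'I_t -> bool}) : rel 'I_t := fun i j => l (i, j).
have /fin_all_exists[u uP] (l : {ffun 'I_t * 'I_t -> bool}) : exists c : R, 0 < c /\
    (is_Theta (fun n => copies_var R m n (rel_of l)) (fun n => n%:R) ->
     \forall n \near \oo, c * n%:R <= copies_var R m n (rel_of l)).
  have [[c [C [c0 _ cC]]]|no] :=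
    pselect (is_Theta (fun n => copies_var R m n (rel_of l)) (fun n => n%:R)); last by exists 1.
  by exists c; split => // _; apply: filterS cC => n /andP[].
pose K l := `|D| / Num.sqrt (u l) ^+ 3.
have K0 l : 0 <= K l by rewrite mulr_ge0// invr_ge0 exprn_ge0// sqrtr_ge0.
(* The sum of nonnegative terms stands in for a maximum; the absolute value in [K] is there because
   no sign of [D] is known. *)
exists (\sum_l K l) => V L Vt LT VTheta.
pose f (i : 'I_t) : V := enum_val (cast_ord (esym Vt) i).
have fb : bijective f.
  exists (fun x => cast_ord Vt (enum_rank x)) => [i|x].
    by rewrite /f enum_valK cast_ordKV.
  by rewrite /f cast_ordK enum_rankK.
pose l : {ffun 'I_t * 'I_t -> bool} := [ffun ij => L (f ij.1) (f ij.2)].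
have varE n : copies_var R m n L = copies_var R m n (rel_of l).
  rewrite !copies_varE (@copies_relabel R m n _ _ (rel_of l) L f fb)// => x y.
  by rewrite /rel_of ffunE.
have [u0 ul] := uP l.
have near_le : \forall n \near \oo, u l * n%:R <= copies_var R m n L.
  under eq_near do rewrite varE; apply: ul.
  by move: VTheta; under [X in is_Theta X _]funext do rewrite varE.
have := Dle (u l) V L u0 Vt LT near_le; apply: filterS => n le.
apply: (le_trans le); rewrite lee_fin ler_wpM2r ?powR_ge0//.
rewrite (bigD1 l)//= (le_trans (_ : _ <= K l))//.
  by rewrite ler_wpM2r ?ler_norm// invr_ge0 exprn_ge0// sqrtr_ge0.
by rewrite lerDl sumr_ge0.
Qed.
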